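(* Let $\Omega\subset\mathbb C^n$ be a domain and $F\subset\partial\Omega$ a closed subset. Assume that $\partial\Omega$ is $\mathcal C^2$-smooth near $F$ and that $\partial\Omega\setminus F$ is locally pseudoconvex. Suppose that $F$ has empty interior relative to $\partial\Omega$. Then $\Omega$ is pseudoconvex.
   Context: ''$\partial\Omega$ is $\mathcal C^2$-smooth near $F$'' means that there is an open neighborhood of $F$ in $\mathbb C^n$ in which $\partial\Omega$ is locally given by $\mathcal C^2$ defining functions (negative exactly on $\Omega$) with nonvanishing gradient. ''$\partial\Omega\setminus F$ is locally pseudoconvex'' means: for any $\zeta\in\partial\Omega\setminus F$ there exists $r>0$ such that $B(\zeta,r)\cap\Omega$ is pseudoconvex, where $B(\zeta,r)$ is the open Euclidean ball. *)

(* Defs.v *)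
From HB Require Import structures.
From mathcomp Require Import all_boot all_order all_algebra.
From mathcomp Require Import all_classical all_reals all_analysis.

Set Implicit Arguments.
Unset Strict Implicit.
Unset Printing Implicit Defensive.

Import Order.TTheory GRing.Theory Num.Theory.
Import numFieldNormedType.Exports.

Local Open Scope classical_set_scope.
Local Open Scope ring_scope.

(* C^n as a real normed space: (x, y) stands for the vector x + i y. The norm
   supplied by the library is the sup norm, so it is used only for the topology
   and for differentiation; Euclidean balls are defined separately below. *)
Notation "''C[' R ]_ n" := (('rV[R]_n * 'rV[R]_n)%type)
  (at level 8, n at level 2, format "''C[' R ]_ n") : type_scope.

Section Defs.
Context {R : realType} {n : nat}.
Implicit Types (z w : 'C[R]_n) (W : set 'C[R]_n).

(* (a + i b) z *)
Definition cmul (a b : R) z : 'C[R]_n :=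
  (a *: z.1 - b *: z.2, a *: z.2 + b *: z.1).

Definition enorm z : R :=
  Num.sqrt (\sum_(j < n) ((z.1 0 j) ^+ 2 + (z.2 0 j) ^+ 2)).

Definition eball z (r : R) : set 'C[R]_n := [set w | enorm (w - z) < r].

Definition boundary W : set 'C[R]_n := closure W `\` interior W.

Definition domain W : Prop := [/\ open W, connected W & W !=set0].

(* The last clause is the sub-mean value property over the boundary circle of
   every closed disc z + tau w, |tau| <= 1, contained in W. The integrand is
   bounded above by upper semicontinuity, so the integral is meaningful (and
   possibly -oo). *)
Definition plurisubharmonic W (u : 'C[R]_n -> \bar R) : Prop :=
  [/\ forall z, W z -> (u z < +oo)%E,
      forall z, W z -> forall a : R, (u z < a%:E)%E ->
        \forall w \near z, (u w < a%:E)%E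
    & forall z w,
        (forall a b : R, a ^+ 2 + b ^+ 2 <= 1 -> W (z + cmul a b w)) ->
        ((2 * pi)%R%:E * u z <=
         \int[@lebesgue_measure R]_(t in `[0%R, (2 * pi)%R])
            u (z + cmul (cos t) (sin t) w)%R)%E].

(* W has a continuous plurisubharmonic exhaustion function. *)
Definition pseudoconvex W : Prop :=
  open W /\ exists u : 'C[R]_n -> R,
    [/\ {in W, continuous u},
        plurisubharmonic W (EFin \o u)
      & forall c : R, compact (W `&` [set z | u z <= c])].

Definition C2_on W (f : 'C[R]_n -> R) : Prop :=
  [/\ {in W, continuous f},
      forall v z : 'C[R]_n, W z ->
        derivable f z v /\ {for z, continuous ('D_v f)}
    & forall v w z : 'C[R]_n, W z ->
        derivable ('D_v f) z w /\ {for z, continuous ('D_w ('D_v f))}].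

(* The gradient with respect to the 2n real coordinates. *)
Definition grad (f : 'C[R]_n -> R) z : 'C[R]_n :=
  (\row_j 'D_((delta_mx 0 j, 0) : 'C[R]_n) f z,
   \row_j 'D_((0, delta_mx 0 j) : 'C[R]_n) f z).

Definition local_defining_function W (V : set 'C[R]_n) (rho : 'C[R]_n -> R) :
    Prop :=
  [/\ C2_on V rho,
      forall z, V z -> grad rho z != 0,
      forall z, V z -> (W z <-> rho z < 0)
    & forall z, V z -> (boundary W z <-> rho z = 0)].

Definition C2_boundary_near W (F : set 'C[R]_n) : Prop :=
  exists U : set 'C[R]_n, [/\ open U, F `<=` U
    & forall zeta, (boundary W `&` U) zeta ->
        exists (V : set 'C[R]_n) (rho : 'C[R]_n -> R),
          [/\ open V, V zeta & local_defining_function W V rho]].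

Definition locally_pseudoconvex_at W z : Prop :=
  exists2 r : R, 0 < r & pseudoconvex (eball z r `&` W).

End Defs.

(* Main.v *)
(* Let [delta] be the Euclidean distance to the complement of [Omega]. The
   exhaustion function is [max (delta^-2) |z|^2], and the point is that
   [delta^-2] is plurisubharmonic. If the sub-mean value inequality fails on a
   disc, comparison with a harmonic polynomial (a Fejer mean of the boundary
   values) gives a point of the disc where [delta^-2] is touched from above by a
   strictly superharmonic quadratic polynomial. Moving towards a nearest boundary
   point [zeta] by the reciprocal of a holomorphic square root of that polynomial
   yields a quadratic analytic disc through [zeta] which otherwise lies in
   [Omega], with quadratic clearance, and which can be pushed into [Omega].
   Off [F] this contradicts the maximum principle for a local plurisubharmonic
   exhaustion. If [zeta] lies in [F], the disc says that the Levi form of the C^2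
   boundary is negative in some tangential direction; this is stable under
   perturbation of [zeta], so such discs also exist at boundary points off [F],
   which accumulate at [zeta] since [F] has empty interior. *)
Require Import Defs.
From HB Require Import structures.
From mathcomp Require Import all_boot all_order all_algebra.
From mathcomp Require Import all_classical all_reals all_analysis.
From mathcomp Require Import ring lra complex.

Set Implicit Arguments.
Unset Strict Implicit.
Unset Printing Implicit Defensive.

Import Order.TTheory GRing.Theory Num.Theory.
Import numFieldNormedType.Exports.

Local Open Scope classical_set_scope.
Local Open Scope ring_scope.

(** * The Euclidean norm *)

Section Euclid.
Context {R : realType} {n : nat}.
Implicit Types (z w v : 'C[R]_n).

(** The exponent -2 keeps everything polynomial. After scaling by [d^2], the touching inequality
    reads [d^2 delta^-2 <= 1 + 2 Re h - eta |s|^2] with [h] a quadratic holomorphic polynomial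
    vanishing at 0, and [1 + 2 Re h <= |1 + h|^2]. Hence [1 + h] serves as the square root, with no
    logarithm or exponential, and all discs can be taken quadratic, which is the order at which a
    C^2 boundary can be tested. Two definitions force detours. Plurisubharmonicity is tested on
    affine discs and [u] is merely continuous, so the maximum principle along a quadratic disc needs
    its own proof. C^2 is expressed by directional derivatives, so linearity in the direction and
    joint continuity have to be derived before expanding at moving points. The disc at [zeta] is
    recorded in two forms. [pushed_disc] is what local pseudoconvexity forbids, but it says nothing
    about neighbouring boundary points. [strict_disc] retains the clearance produced by
    [- eta |s|^2]; this has the order of the second-order term of a defining function, and so yields
    a strict inequality that survives perturbation. *)

Definition dot z w : R :=
  \sum_(j < n) (z.1 0 j * w.1 0 j + z.2 0 j * w.2 0 j).

Lemma dotC z w : dot z w = dot w z.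
Proof. by apply: eq_bigr => j _; ring. Qed.

Lemma dotDl z w v : dot (z + w) v = dot z v + dot w v.
Proof. by rewrite -big_split; apply: eq_bigr => j _; rewrite /= !mxE; ring. Qed.

Lemma dotZl (a : R) z v : dot (a *: z) v = a * dot z v.
Proof. by rewrite mulr_sumr; apply: eq_bigr => j _; rewrite /= !mxE; ring. Qed.

Lemma dotNl z v : dot (- z) v = - dot z v.
Proof. by rewrite -scaleN1r dotZl mulN1r. Qed.

Lemma dotDr z w v : dot v (z + w) = dot v z + dot v w.
Proof. by rewrite dotC dotDl !(dotC _ v). Qed.

Lemma dotZr (a : R) z v : dot v (a *: z) = a * dot v z.
Proof. by rewrite dotC dotZl dotC. Qed.

Lemma dotNr z v : dot v (- z) = - dot v z.
Proof. by rewrite dotC dotNl dotC. Qed.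

Lemma dot_ge0 z : 0 <= dot z z.
Proof. by apply: sumr_ge0 => j _; rewrite addr_ge0 // -expr2 sqr_ge0. Qed.

Lemma sqr_enorm z : enorm z ^+ 2 = dot z z.
Proof.
rewrite /enorm sqr_sqrtr; first by apply: eq_bigr => j _; rewrite !expr2.
by apply: sumr_ge0 => j _; rewrite addr_ge0 // sqr_ge0.
Qed.

Lemma enorm_ge0 z : 0 <= enorm z.
Proof. exact: sqrtr_ge0. Qed.
Hint Resolve enorm_ge0 : core.

Lemma dot_le z w : dot z w <= enorm z * enorm w.
Proof.
have h (a b : R) : 0 <= a ^+ 2 * dot z z - 2 * (a * b) * dot z w + b ^+ 2 * dot w w.
  have h0 := dot_ge0 (a *: z - b *: w); move: h0.
  rewrite dotDl !dotDr !dotNl !dotNr !dotZl !dotZr (dotC w z).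
  by move=> h0; apply: (le_trans h0); rewrite le_eqVlt; apply/orP; left; apply/eqP; ring.
have := h (enorm w) (enorm z); rewrite -!sqr_enorm.
have := enorm_ge0 z; have := enorm_ge0 w.
set a := enorm w; set b := enorm z => a0 b0 H.
have [a00|a00] := eqVneq a 0.
  have ww : dot w w = 0 by rewrite -sqr_enorm -/a a00 expr0n.
  (* When [dot w w = 0] these weights turn the square into [- (dot z w)^2 (dot z z + 2)], which
     forces [dot z w = 0]. *)
  have := h (dot z w) (dot z z + 1); have := dot_ge0 z.
  rewrite ww a00 !mulr0 addr0; move=> zz hh.
  have : dot z w ^+ 2 * (dot z z + 2) <= 0 by lra.
  by rewrite pmulr_lle0 ?ltr_wpDl // => k; nra.
have [b00|b00] := eqVneq b 0.
  have zz : dot z z = 0 by rewrite -sqr_enorm -/b b00 expr0n.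
  have := h (dot w w + 1) (dot z w); have := dot_ge0 w.
  rewrite zz b00 mulr0 mul0r; move=> ww hh.
  have : dot z w ^+ 2 * (dot w w + 2) <= 0 by lra.
  by rewrite pmulr_lle0 ?ltr_wpDl // => k; nra.
have a1 : 0 < a by rewrite lt_neqAle eq_sym a00.
have b1 : 0 < b by rewrite lt_neqAle eq_sym b00.
have ab : 0 < a * b by rewrite mulr_gt0.
rewrite -(ler_pM2l ab); nra.
Qed.

Lemma enormD z w : enorm (z + w) <= enorm z + enorm w.
Proof.
rewrite -(@ler_pXn2r _ 2) ?nnegrE ?addr_ge0 //.
rewrite sqrrD !sqr_enorm dotDl !dotDr (dotC w z).
by have := dot_le z w; lra.
Qed.

Lemma enormN z : enorm (- z) = enorm z.
Proof. by congr Num.sqrt; apply: eq_bigr => j _; rewrite /= !mxE !sqrrN. Qed.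

Lemma enormB z w : enorm (z - w) = enorm (w - z).
Proof. by rewrite -enormN opprB. Qed.

Lemma enorm_cmul (a b : R) z :
  enorm (cmul a b z) = Num.sqrt (a ^+ 2 + b ^+ 2) * enorm z.
Proof.
rewrite -sqrtrM ?addr_ge0 ?sqr_ge0 //; congr Num.sqrt.
by rewrite mulr_sumr; apply: eq_bigr => j _; rewrite /= !mxE; ring.
Qed.

Lemma enormZ (a : R) z : enorm (a *: z) = `|a| * enorm z.
Proof.
rewrite -sqrtr_sqr -sqrtrM ?sqr_ge0 //; congr Num.sqrt.
by rewrite mulr_sumr; apply: eq_bigr => j _; rewrite /= !mxE; ring.
Qed.

Lemma enorm0 : enorm (0 : 'C[R]_n) = 0.
Proof. by rewrite -(scale0r 0) enormZ normr0 mul0r. Qed.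

(** One half of the comparison with the sup norm; for the other half the continuity of [enorm] is
    enough to make Euclidean balls a neighbourhood base. *)
Lemma normr_le_enorm z : `|z| <= enorm z.
Proof.
have coord (x : 'rV[R]_n) :
    (forall j, `|x 0 j| <= enorm z) -> `|x| <= enorm z.
  move=> h; rewrite {1}/Num.norm /= mx_normrE; apply/bigmax_leP; split => //= -[i j] _ /=.
  by rewrite (ord1 i).
have le j (t : R) : t ^+ 2 <= (z.1 0 j) ^+ 2 + (z.2 0 j) ^+ 2 ->
    `|t| <= enorm z.
  move=> h; rewrite -sqrtr_sqr ler_wsqrtr // (le_trans h) //.
  rewrite (bigD1 j) //= lerDl sumr_ge0 // => i _; by rewrite addr_ge0 // sqr_ge0.
rewrite {1}/Num.norm /= ge_max; apply/andP; split; apply: coord => j; apply: (le j).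
  by rewrite lerDl sqr_ge0.
by rewrite lerDr sqr_ge0.
Qed.

Lemma enorm_eq0 z : (enorm z == 0) = (z == 0).
Proof.
apply/eqP/eqP => [h|->]; last exact: enorm0.
by apply/eqP; rewrite -normr_le0 (le_trans (normr_le_enorm z)) // h.
Qed.

Lemma enorm_gt0 z : (0 < enorm z) = (z != 0).
Proof. by rewrite lt_def enorm_ge0 andbT enorm_eq0. Qed.

Lemma dot_continuous : continuous (fun p : 'C[R]_n * 'C[R]_n => dot p.1 p.2).
Proof.
apply: continuous_big => [|j _ q]; first exact: add_continuous.
have c1 : continuous (fun q : 'C[R]_n * 'C[R]_n => q.1.1 0 j).
  move=> s; apply: (@continuous_comp _ _ _ (fun q : 'C[R]_n * 'C[R]_n => q.1.1)
     (fun x : 'rV[R]_n => x 0 j)); last exact: coord_continuous.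
  by apply: (@continuous_comp _ _ _ fst fst); exact: cvg_fst.
have c2 : continuous (fun q : 'C[R]_n * 'C[R]_n => q.1.2 0 j).
  move=> s; apply: (@continuous_comp _ _ _ (fun q : 'C[R]_n * 'C[R]_n => q.1.2)
     (fun x : 'rV[R]_n => x 0 j)); last exact: coord_continuous.
  by apply: (@continuous_comp _ _ _ fst snd); [exact: cvg_fst|exact: cvg_snd].
have c3 : continuous (fun q : 'C[R]_n * 'C[R]_n => q.2.1 0 j).
  move=> s; apply: (@continuous_comp _ _ _ (fun q : 'C[R]_n * 'C[R]_n => q.2.1)
     (fun x : 'rV[R]_n => x 0 j)); last exact: coord_continuous.
  by apply: (@continuous_comp _ _ _ snd fst); [exact: cvg_snd|exact: cvg_fst].
have c4 : continuous (fun q : 'C[R]_n * 'C[R]_n => q.2.2 0 j).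
  move=> s; apply: (@continuous_comp _ _ _ (fun q : 'C[R]_n * 'C[R]_n => q.2.2)
     (fun x : 'rV[R]_n => x 0 j)); last exact: coord_continuous.
  by apply: (@continuous_comp _ _ _ snd snd); exact: cvg_snd.
exact: (cvgD (cvgM (c1 q) (c3 q)) (cvgM (c2 q) (c4 q))).
Qed.

Lemma enorm_continuous : continuous (@enorm R n).
Proof.
move=> z; have -> : @enorm R n = (fun z => Num.sqrt (dot z z)).
  by apply/funext => w; rewrite -sqr_enorm sqrtr_sqr ger0_norm.
apply: (@continuous_comp _ _ _ (fun z => dot z z) Num.sqrt);
  last exact: sqrt_continuous.
apply: (@continuous_comp _ _ _ (fun z : 'C[R]_n => (z, z))
  (fun p => dot p.1 p.2)); last exact: dot_continuous.
exact: (cvg_pair cvg_id cvg_id).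
Qed.

Lemma nbhs_eball z (r : R) : 0 < r -> nbhs z (eball z r).
Proof.
move=> r0; have : (fun w => enorm (w - z)) @ z --> enorm (z - z).
  apply: (@continuous_comp _ _ _ (fun w => w - z) (@enorm R n));
    last exact: enorm_continuous.
  by apply: cvgB; [exact: cvg_id|exact: cvg_cst].
by rewrite subrr enorm0 => /cvgr_lt; apply.
Qed.

Lemma nbhs_eballP z (U : set 'C[R]_n) :
  nbhs z U <-> exists2 r : R, 0 < r & eball z r `<=` U.
Proof.
split=> [/nbhs_ballP[r r0 h]|[r r0 h]]; last exact: filterS h (nbhs_eball _ r0).
exists r => // w; rewrite /eball /= => wr; apply: h.
rewrite -ball_normE /= distrC; exact: le_lt_trans (normr_le_enorm _) wr.
Qed.

Lemma compact_enorm_le (r : R) : compact [set z : 'C[R]_n | enorm z <= r].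
Proof.
have cB : compact [set x : 'rV[R]_n | `|x| <= r].
  apply: bounded_closed_compact.
    exists r; split; first exact: num_real.
    by move=> M rM x /= h; apply: le_trans h (ltW rM).
  apply: (@preimage_closed _ _ (fun x : 'rV[R]_n => `|x|) [set t | t <= r]).
    by move=> x _; exact: norm_continuous.
  exact: closed_le.
apply: (subclosed_compact _ (compact_setX cB cB)).
  apply: (@preimage_closed _ _ (@enorm R n) [set t | t <= r]).
    by move=> x _; exact: enorm_continuous.
  exact: closed_le.
move=> z /= h; have := le_trans (normr_le_enorm z) h.
by rewrite {1}/Num.norm /= ge_max => /andP[].
Qed.

Lemma closed_enorm_bounded_compact (A : set 'C[R]_n) (r : R) :
  closed A -> (forall z, A z -> enorm z <= r) -> compact A.
Proof. by move=> cA h; exact: (subclosed_compact cA (@compact_enorm_le r) h). Qed.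

End Euclid.
#[export] Hint Resolve enorm_ge0 : core.

Lemma continuous_compact_max (T : topologicalType) (R : realType) (f : T -> R)
    (A : set T) : A !=set0 -> compact A ->
    (forall x, A x -> {for x, continuous f}) ->
  exists2 c, A c & forall t, A t -> f t <= f c.
Proof.
move=> A0 cA cf; have [|c /set_mem Ac h] := @compact_EVT_max T R f A A0 cA.
  by apply: continuous_in_subspaceT => x /set_mem; exact: cf.
by exists c => // t At; apply: h; rewrite inE.
Qed.

Lemma continuous_compact_min (T : topologicalType) (R : realType) (f : T -> R)
    (A : set T) : A !=set0 -> compact A ->
    (forall x, A x -> {for x, continuous f}) ->
  exists2 c, A c & forall t, A t -> f c <= f t.
Proof.
move=> A0 cA cf; have [|c /set_mem Ac h] := @compact_EVT_min T R f A A0 cA.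
  by apply: continuous_in_subspaceT => x /set_mem; exact: cf.
by exists c => // t At; apply: h; rewrite inE.
Qed.

Lemma Cn_ext (R : realType) (n : nat) (z w : 'C[R]_n) :
  (forall j, z.1 0 j = w.1 0 j) -> (forall j, z.2 0 j = w.2 0 j) -> z = w.
Proof.
case: z w => [a b] [c d] /= h1 h2.
by congr pair; apply/rowP => j.
Qed.

Ltac vring := apply: Cn_ext => j; rewrite /= ?mxE; ring.

(** * Distance to the complement *)

Section Distance.
Context {R : realType} {n : nat}.
Implicit Types (z w v : 'C[R]_n) (W : set 'C[R]_n).

(** For [W = setT] the infimum is over the empty set and has only a default value; this is why
    [W <> setT] is assumed below and the whole space is treated separately. *)
Definition dist W z : R := inf [set enorm (z - w) | w in ~` W].

Lemma dist_nearest W z : open W -> W <> setT ->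
  exists2 w, ~ W w & dist W z = enorm (z - w).
Proof.
move=> oW WT; have [w0 Ww0] : exists w, ~ W w.
  by apply: contrapT => /forallNP h; apply: WT; rewrite -subTset => w _; apply: contrapT.
(* Only points of the complement at most as far as [w0] compete for the infimum, and they form a
   compact set. *)
pose A := ~` W `&` [set w | enorm (z - w) <= enorm (z - w0)].
have cz : continuous (fun w => enorm (z - w)).
  move=> w; apply: (@continuous_comp _ _ _ (fun w => z - w) (@enorm R n));
    last exact: enorm_continuous.
  by apply: cvgB; [exact: cvg_cst|exact: cvg_id].
have cA : compact A.
  apply: (@closed_enorm_bounded_compact _ _ _ (enorm z + enorm (z - w0))).
    apply: closedI; first exact: open_closedC.
    apply: (@preimage_closed _ _ (fun w => enorm (z - w)) [set t | t <= enorm (z - w0)]).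
      by move=> w _; exact: (cz w).
    exact: closed_le.
  move=> w [_ /= h]; rewrite (_ : w = z - (z - w)); last by rewrite subKr.
  by apply: le_trans (enormD _ _) _; rewrite enormN lerD2l.
have A0 : A !=set0 by exists w0; split => /=.
have [|w [Ww wle] wmin] := continuous_compact_min A0 cA (f := fun w => enorm (z - w)).
  by move=> w _; exact: (cz w).
exists w => //; apply/eqP; rewrite eq_le; apply/andP; split.
  by apply: ge_inf; [exists 0 => _ [v _ <-]; exact: enorm_ge0|exists w].
apply: lb_le_inf; first by exists (enorm (z - w)), w.
move=> _ [v Wv <-]; have [h|h] := leP (enorm (z - v)) (enorm (z - w0)).
  by apply: wmin; split.
exact: le_trans wle (ltW h).
Qed.

Lemma dist_le W z w : ~ W w -> dist W z <= enorm (z - w).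
Proof.
move=> Ww; by apply: ge_inf; [exists 0 => _ [v _ <-]; exact: enorm_ge0|exists w].
Qed.

Lemma dist_ball W z w : enorm (w - z) < dist W z -> W w.
Proof.
rewrite enormB => h; apply: contrapT => /(@dist_le W z).
by rewrite leNgt h.
Qed.

Variable W : set 'C[R]_n.
Hypotheses (oW : open W) (WT : W <> setT).

Lemma dist_gt0 z : W z -> 0 < dist W z.
Proof.
move=> Wz; have [w Ww ->] := dist_nearest z oW WT.
by rewrite enorm_gt0 subr_eq0; apply/eqP => zw; apply: Ww; rewrite -zw.
Qed.

Lemma dist_lipschitz z w : dist W z <= dist W w + enorm (z - w).
Proof.
have [v Wv ->] := dist_nearest w oW WT; apply: le_trans (dist_le _ Wv) _.
by rewrite (_ : z - v = (w - v) + (z - w)) ?enormD //; vring.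
Qed.

Lemma dist_continuous : continuous (dist W).
Proof.
move=> z; apply/cvgrPdist_lt => e e0.
have := nbhs_eball z e0; apply: filterS => w; rewrite /eball /= => h.
rewrite ltr_norml; have := dist_lipschitz z w; have := dist_lipschitz w z.
rewrite (enormB z w); lra.
Qed.

(** The segment from [w] to [z], without [w], lies in the open ball of radius [dist W z] about [z],
    hence in [W], and it accumulates at [w]. *)
Lemma nearest_boundary z w : W z -> ~ W w -> dist W z = enorm (z - w) ->
  boundary W w.
Proof.
move=> Wz Ww zw; split; last by move=> /interior_subset.
move=> U /nbhs_eballP[r r0 rU].
have d0 := dist_gt0 Wz.
pose t := Num.min (1/2) (r / (2 * dist W z)).
have t0 : 0 < t by rewrite lt_min; apply/andP; split; rewrite divr_gt0 ?mulr_gt0.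
have t1 : t < 1 by rewrite gt_min; apply/orP; left; lra.
have tr : t * dist W z < r.
  have : t <= r / (2 * dist W z) by rewrite ge_min lexx orbT.
  by rewrite ler_pdivlMr ?mulr_gt0 // => h; lra.
exists (w + t *: (z - w)); split.
  apply: (dist_ball (z := z)).
  rewrite (_ : _ - z = (t - 1) *: (z - w)); last first.
    by vring.
  rewrite enormZ ltr0_norm ?subr_lt0 // -zw; nra.
by apply: rU; rewrite /eball /= addrAC subrr add0r enormZ -zw gtr0_norm.
Qed.

End Distance.

Lemma compact_open_tube (R : realType) (n : nat) (K W : set 'C[R]_n) :
  compact K -> open W -> K `<=` W ->
  exists2 k : R, 0 < k & forall z y, K z -> enorm y <= k -> W (z + y).
Proof.
move=> cK oW KW; have [->|WT] := pselect (W = setT); first by exists 1.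
have [->|/set0P K0] := eqVneq K set0; first by exists 1.
have [|z Kz zmin] := continuous_compact_min K0 cK (f := dist W).
  by move=> z _; exact: dist_continuous.
exists (dist W z / 2); first by rewrite divr_gt0 // dist_gt0 //; exact: KW.
move=> w y Kw yle; apply: (dist_ball (z := w)); rewrite addrAC subrr add0r.
have := zmin _ Kw; have := dist_gt0 oW WT (KW _ Kz); lra.
Qed.

(** * Means over circles and the maximum principle *)

Section CircleIntegral.
Context {R : realType}.
Implicit Types f g : R -> R.

(** Real-valued and not divided by [2 pi], so that it matches the extended-real integral in the
    definition of plurisubharmonicity, to which [submean_cint] links it. *)
Definition cint f : R := \int[@lebesgue_measure R]_(t in `[0, 2 * pi]) f t.

Lemma cint_integrable f : continuous f ->
  (@lebesgue_measure R).-integrable `[0, 2 * pi] (EFin \o f).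
Proof.
move=> cf; apply: continuous_compact_integrable; first exact: segment_compact.
by apply: continuous_subspaceT => x; exact: cf.
Qed.

Lemma cintD f g : continuous f -> continuous g ->
  cint (fun t => f t + g t) = cint f + cint g.
Proof. by move=> cf cg; apply: RintegralD => //; exact: cint_integrable. Qed.

Lemma cintZ (a : R) f : continuous f -> cint (fun t => a * f t) = a * cint f.
Proof. by move=> cf; apply: RintegralZl => //; exact: cint_integrable. Qed.

Lemma le_cint f g : continuous f -> continuous g -> (forall t, f t <= g t) ->
  cint f <= cint g.
Proof.
by move=> cf cg fg; apply: le_Rintegral => //; exact: cint_integrable.
Qed.

Lemma cint_cst (a : R) : cint (fun=> a) = 2 * pi * a.
Proof.
rewrite /cint Rintegral_cst //= lebesgue_measure_itv /= lte_fin.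
by rewrite mulr_gt0 ?pi_gt0 //= oppr0 addr0 mulrC.
Qed.

Lemma cint_FTC f F : continuous f -> (forall t : R, is_derive t (1 : R) F (f t)) ->
  F 0 = F (2 * pi) -> cint f = 0.
Proof.
move=> cf dF F0; rewrite /cint /Rintegral.
rewrite (@continuous_FTC2 _ f F) ?mulr_gt0 ?pi_gt0 //.
- by rewrite F0 subee.
- by apply: continuous_subspaceT => x; exact: cf.
- have cF t : {for t, continuous F}.
    by apply: differentiable_continuous; apply/derivable1_diffP; have [] := dF t.
  split; first by move=> t _; have [] := dF t.
    by apply: cvg_at_right_filter; exact: cF.
  by apply: cvg_at_left_filter; exact: cF.
- by move=> t _; rewrite derive1E; apply: derive_val.
Qed.

End CircleIntegral.

Section CircleTrig.
Context {R : realType}.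

Lemma cos_sin_2pi_nat (k : nat) :
  cos (k%:R * (2 * pi)) = 1 :> R /\ sin (k%:R * (2 * pi)) = 0 :> R.
Proof.
have c2 : cos (2 * pi) = 1 :> R by rewrite mulr_natl cos2pi.
have s2 : sin (2 * pi) = 0 :> R by rewrite mulr_natl sin2pi.
elim: k => [|k [c s]]; first by rewrite mul0r cos0 sin0.
by rewrite -natr1 mulrDl mul1r cosD sinD c s c2 s2; split; ring.
Qed.

Lemma cos_mul_continuous (k : R) : continuous (fun t => cos (k * t)).
Proof.
move=> t; apply: (@continuous_comp _ _ _ (fun t => k * t) cos);
  last exact: continuous_cos.
by apply: cvgM; [exact: cvg_cst|exact: cvg_id].
Qed.

Lemma sin_mul_continuous (k : R) : continuous (fun t => sin (k * t)).
Proof.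
move=> t; apply: (@continuous_comp _ _ _ (fun t => k * t) sin);
  last exact: continuous_sin.
by apply: cvgM; [exact: cvg_cst|exact: cvg_id].
Qed.

Lemma cint_cos (k : nat) : (0 < k)%N -> cint (fun t : R => cos (k%:R * t)) = 0.
Proof.
move=> k0; have kn : k%:R != 0 :> R by rewrite pnatr_eq0 -lt0n.
apply: (@cint_FTC _ _ (fun t => k%:R^-1 * sin (k%:R * t))).
- exact: cos_mul_continuous.
- move=> t; apply: is_derive_eq.
  by rewrite /GRing.scale /= mulr1; field.
- by have [_ ->] := cos_sin_2pi_nat k; rewrite mulr0 sin0.
Qed.

Lemma cint_sin (k : nat) : (0 < k)%N -> cint (fun t : R => sin (k%:R * t)) = 0.
Proof.
move=> k0; have kn : k%:R != 0 :> R by rewrite pnatr_eq0 -lt0n.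
apply: (@cint_FTC _ _ (fun t => - k%:R^-1 * cos (k%:R * t))).
- exact: sin_mul_continuous.
- move=> t; apply: is_derive_eq.
  by rewrite /GRing.scale /= mulr1; field.
- by have [-> _] := cos_sin_2pi_nat k; rewrite mulr0 cos0.
Qed.

(** By the double-angle formulas the last two terms are [cos 2t] and [sin 2t], so only the constant
    survives. Restrictions of quadratic expressions to a circle have this shape. *)
Lemma cint_trig2 (K a b c d : R) :
  cint (fun t => K + (a * cos t + b * sin t)
                 + (c * (cos t ^+ 2 - sin t ^+ 2) + d * (2 * cos t * sin t)))
  = 2 * pi * K.
Proof.
have -> : (fun t => K + (a * cos t + b * sin t)
      + (c * (cos t ^+ 2 - sin t ^+ 2) + d * (2 * cos t * sin t))) =
    (fun t => K + (a * cos (1%:R * t) + b * sin (1%:R * t))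
      + (c * cos (2%:R * t) + d * sin (2%:R * t))).
  by apply/funext => t; rewrite !mul1r (_ : 2 * t = t + t) ?cosD ?sinD; ring.
have cc (k e : R) : continuous (fun t => e * cos (k * t)).
  by move=> t; apply: cvgM; [exact: cvg_cst|exact: cos_mul_continuous].
have cs (k e : R) : continuous (fun t => e * sin (k * t)).
  by move=> t; apply: cvgM; [exact: cvg_cst|exact: sin_mul_continuous].
have cD (f g : R -> R) : continuous f -> continuous g ->
    continuous (fun t => f t + g t).
  by move=> cf cg t; apply: cvgD; [exact: cf|exact: cg].
have c0 : continuous (fun _ : R => K) by move=> t; exact: cvg_cst.
have c1 (k e f : R) : continuous (fun t => e * cos (k * t) + f * sin (k * t)).
  exact: cD (cc _ _) (cs _ _).
have c2 := cD _ _ c0 (c1 1%:R a b).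
rewrite (cintD c2 (c1 2 c d)) (cintD c0 (c1 _ _ _)).
rewrite (cintD (cc _ _) (cs _ _)) (cintD (cc 2 c) (cs 2 d)).
have z1 (k : nat) (e : R) : (0 < k)%N -> cint (fun t => e * cos (k%:R * t)) = 0.
  by move=> k0; rewrite (cintZ e (@cos_mul_continuous k%:R)) cint_cos // mulr0.
have z2 (k : nat) (e : R) : (0 < k)%N -> cint (fun t => e * sin (k%:R * t)) = 0.
  by move=> k0; rewrite (cintZ e (@sin_mul_continuous k%:R)) cint_sin // mulr0.
by rewrite (z1 1%N) ?(z1 2%N) ?(z2 1%N) ?(z2 2%N) // cint_cst !addr0.
Qed.

End CircleTrig.

Section MaximumPrinciple.
Context {R : realType} {n : nat}.
Implicit Types (z w p A B N y : 'C[R]_n) (G : set 'C[R]_n) (u : 'C[R]_n -> R).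

Lemma cmulE (a b : R) z : cmul a b z = a *: z + b *: cmul 0 1 z.
Proof. by vring. Qed.

Lemma cmul_continuous z : continuous (fun s : R * R => cmul s.1 s.2 z).
Proof.
move=> s; under eq_fun do rewrite cmulE.
apply: cvgD; apply: cvgZr_tmp.
  exact: cvg_fst.
exact: cvg_snd.
Qed.

Lemma circle_continuous z w :
  continuous (fun t : R => z + cmul (cos t) (sin t) w).
Proof.
move=> t; apply: cvgD; first exact: cvg_cst.
apply: (@continuous_comp _ _ _ (fun t : R => (cos t, sin t))
  (fun s : R * R => cmul s.1 s.2 w)); last exact: cmul_continuous.
exact: (cvg_pair (@continuous_cos R t) (@continuous_sin R t)).
Qed.

Lemma circle_comp_continuous G u z w : {in G, continuous u} ->
    (forall a b : R, a ^+ 2 + b ^+ 2 <= 1 -> G (z + cmul a b w)) ->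
  continuous (fun t : R => u (z + cmul (cos t) (sin t) w)).
Proof.
move=> cu hG t.
apply: (@continuous_comp _ _ _ (fun t : R => z + cmul (cos t) (sin t) w) u).
  exact: circle_continuous.
by apply: cu; rewrite inE; apply: hG; rewrite cos2Dsin2.
Qed.

Lemma submean_cint G u z w : {in G, continuous u} ->
    (forall a b : R, a ^+ 2 + b ^+ 2 <= 1 -> G (z + cmul a b w)) ->
  ((2 * pi)%R%:E * (EFin \o u) z <=
     \int[@lebesgue_measure R]_(t in `[0%R, (2 * pi)%R])
       (EFin \o u) (z + cmul (cos t) (sin t) w)%R)%E =
  (2 * pi * u z <= cint (fun t => u (z + cmul (cos t) (sin t) w))).
Proof.
move=> cu hG; rewrite /cint /Rintegral -lee_fin fineK //.
apply: integrable_fin_num => //; apply: cint_integrable.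
exact: circle_comp_continuous cu hG.
Qed.

(** Finiteness and upper semicontinuity follow from continuity, which leaves an inequality between
    real integrals. *)
Lemma psh_submean G u : {in G, continuous u} ->
  plurisubharmonic G (EFin \o u) <->
  forall z w, (forall a b : R, a ^+ 2 + b ^+ 2 <= 1 -> G (z + cmul a b w)) ->
    2 * pi * u z <= cint (fun t => u (z + cmul (cos t) (sin t) w)).
Proof.
move=> cu; split=> [[_ _ h] z w hG|h].
  by rewrite -(submean_cint cu hG); exact: h.
split=> [z _|z Gz a|z w hG]; first by rewrite /= ltry.
  rewrite lte_fin => ua.
  have : u @ z --> u z by apply: cu; rewrite inE.
  by move/cvgr_lt => /(_ a ua); apply: filterS => w; rewrite /= lte_fin.
by rewrite (submean_cint cu hG); exact: h.
Qed.

(** The holomorphic disc [s -> p + s A + s^2 B] at [s = a + i b]. *)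
Definition qdisc p A B (a b : R) : 'C[R]_n :=
  p + cmul a b A + cmul (a ^+ 2 - b ^+ 2) (2 * a * b) B.

Lemma cvg_sqr (T : topologicalType) (f : T -> R) (x : T) :
  f @ x --> f x -> (fun t => f t ^+ 2) @ x --> f x ^+ 2.
Proof.
move=> cf; apply: (@continuous_comp _ _ _ f (fun t => t ^+ 2)) => //.
exact: exprn_continuous.
Qed.

Lemma qdisc_continuous p A B :
  continuous (fun s : R * R => qdisc p A B s.1 s.2).
Proof.
move=> s; apply: cvgD.
  by apply: cvgD; [exact: cvg_cst|exact: cmul_continuous].
apply: (@continuous_comp _ _ _
  (fun s : R * R => (s.1 ^+ 2 - s.2 ^+ 2, 2 * s.1 * s.2))
  (fun s : R * R => cmul s.1 s.2 B)); last exact: cmul_continuous.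
have c1 : fst @ s --> s.1 by exact: cvg_fst.
have c2 : snd @ s --> s.2 by exact: cvg_snd.
have d1 : (fun s : R * R => s.1 ^+ 2 - s.2 ^+ 2) @ s --> s.1 ^+ 2 - s.2 ^+ 2.
  exact: (cvgB (cvg_sqr c1) (cvg_sqr c2)).
have d2 : (fun s : R * R => 2 * s.1 * s.2) @ s --> 2 * s.1 * s.2.
  exact: (cvgM (cvgM (cvg_cst _) c1) c2).
exact: (cvg_pair d1 d2).
Qed.

Lemma compact_disc (r : R) :
  compact [set s : R * R | s.1 ^+ 2 + s.2 ^+ 2 <= r ^+ 2].
Proof.
apply: (@subclosed_compact _ _ (`[- `|r|, `|r|] `*` `[- `|r|, `|r|])).
- apply: (@preimage_closed _ _ (fun s : R * R => s.1 ^+ 2 + s.2 ^+ 2)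
    [set t | t <= r ^+ 2]); last exact: closed_le.
  move=> s _; have c1 : fst @ s --> s.1 by exact: cvg_fst.
  have c2 : snd @ s --> s.2 by exact: cvg_snd.
  exact: (cvgD (cvg_sqr c1) (cvg_sqr c2)).
- by apply: compact_setX; exact: segment_compact.
- move=> [a b] /= h; split; rewrite /= in_itv /= -ler_norml -sqrtr_sqr -[leRHS]sqrtr_sqr ler_wsqrtr //;
    move: h; have := sqr_ge0 a; have := sqr_ge0 b; lra.
Qed.

Lemma compact_circle (r : R) :
  compact [set s : R * R | s.1 ^+ 2 + s.2 ^+ 2 = r ^+ 2].
Proof.
apply: (subclosed_compact _ (@compact_disc r)); last by move=> s /= ->.
apply: (@preimage_closed _ _ (fun s : R * R => s.1 ^+ 2 + s.2 ^+ 2) [set r ^+ 2]).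
  move=> s _; have c1 : fst @ s --> s.1 by exact: cvg_fst.
  have c2 : snd @ s --> s.2 by exact: cvg_snd.
  exact: (cvgD (cvg_sqr c1) (cvg_sqr c2)).
exact: closed_eq.
Qed.

(* [|y - s^2 B|^2] has mean [|y|^2 + |s|^4 |B|^2] over the circles [|s| = r],
   since its cross term is harmonic in [s]. *)
Lemma dot_sub_cmul (a b : R) y B :
  dot (y - cmul a b B) (y - cmul a b B) =
  dot y y - 2 * (a * dot y B + b * dot y (cmul 0 1 B))
  + (a ^+ 2 + b ^+ 2) * dot B B.
Proof.
have iB : dot (cmul 0 1 B) (cmul 0 1 B) = dot B B.
  by rewrite -!sqr_enorm enorm_cmul expr0n expr1n add0r sqrtr1 mul1r.
have Bi : dot B (cmul 0 1 B) = 0.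
  by apply: big1 => j _; rewrite /= !mxE; ring.
rewrite cmulE !opprD !dotDl !dotDr !dotNl !dotNr !dotZl !dotZr iB.
rewrite (dotC (cmul _ _ _) B) Bi (dotC (cmul _ _ _) y) (dotC B y).
ring.
Qed.

Lemma near_disc (a b r : R) : a ^+ 2 + b ^+ 2 < r ^+ 2 ->
  exists2 t : R, 0 < t & forall s x y : R, 0 <= s <= t ->
    x ^+ 2 + y ^+ 2 <= 1 -> (a + s * x) ^+ 2 + (b + s * y) ^+ 2 <= r ^+ 2.
Proof.
(* For [s <= 1] one has [s^2 <= s], so the squared modulus grows by at most [s * m]. *)
move=> h; pose m := 2 * (`|a| + `|b|) + 1.
have m0 : 0 < m by rewrite ltr_wpDl // mulr_ge0 // addr_ge0.
pose d := r ^+ 2 - (a ^+ 2 + b ^+ 2).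
have d0 : 0 < d by rewrite subr_gt0.
exists (Num.min 1 (d / m)); first by rewrite lt_min ltr01 divr_gt0.
move=> s x y /andP[s0]; rewrite le_min => /andP[s1].
rewrite ler_pdivlMr // => sm xy.
have x1 : `|x| <= 1.
  rewrite -(@ler_pXn2r _ 2) ?nnegrE // expr1n -normrX ger0_norm ?sqr_ge0 //.
  by have := sqr_ge0 y; lra.
have y1 : `|y| <= 1.
  rewrite -(@ler_pXn2r _ 2) ?nnegrE // expr1n -normrX ger0_norm ?sqr_ge0 //.
  by have := sqr_ge0 x; lra.
have ax : a * x <= `|a|.
  by apply: (le_trans (ler_norm _)); rewrite normrM ler_piMr.
have bx : b * y <= `|b|.
  by apply: (le_trans (ler_norm _)); rewrite normrM ler_piMr.
rewrite /m /d in sm.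
have h1 : s * (a * x + b * y) <= s * (`|a| + `|b|) by rewrite ler_wpM2l ?lerD.
have h2 : s ^+ 2 * (x ^+ 2 + y ^+ 2) <= s.
  apply: (@le_trans _ _ (s ^+ 2)); first by rewrite ler_piMr ?sqr_ge0.
  by rewrite expr2 ler_piMr.
lra.
Qed.

(* Maximize [u (phi s + y) - N |y|^2 + eta |s|^2] over a tube around the disc
   [phi]. At an interior maximum [(s0, y0)], moving along [phi' s0] keeps
   [y - y0] quadratic in [s], hence the sub-mean value property fails. *)
Lemma disc_max_principle G u p A B (r M : R) : open G -> {in G, continuous u} ->
    plurisubharmonic G (EFin \o u) -> 0 < r ->
    (forall a b, a ^+ 2 + b ^+ 2 <= r ^+ 2 -> G (qdisc p A B a b)) ->
    (forall a b, a ^+ 2 + b ^+ 2 = r ^+ 2 -> u (qdisc p A B a b) <= M) ->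
  u p <= M.
Proof.
move=> oG cu /(psh_submean cu) hu r0 GD uM; rewrite leNgt; apply/negP => Mu.
have p0 : qdisc p A B 0 0 = p by vring.
pose d := u p - M; have d0 : 0 < d by rewrite subr_gt0.
pose D := [set s : R * R | s.1 ^+ 2 + s.2 ^+ 2 <= r ^+ 2].
pose f := fun s : R * R => qdisc p A B s.1 s.2.
have cf : continuous f := @qdisc_continuous p A B.
have cD : compact D := @compact_disc r.
pose S := [set s : R * R | s.1 ^+ 2 + s.2 ^+ 2 = r ^+ 2].
have cS : compact S := @compact_circle r.
have cK (E : set (R * R)) : compact E -> compact (f @` E).
  by move=> cE; apply: continuous_compact => //; apply: continuous_subspaceT => x; exact: cf.
have [k1 k10 hk1] := compact_open_tube (cK _ cD) oG
  (fun z (h : (f @` D) z) => let: ex_intro2 s Ds e := h in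
     eq_ind _ G (GD _ _ Ds) _ e).
(* Over the boundary circle the tube is made so thin that [u < M + d / 4] on it. Since the bonus
   [eta |s|^2] is [d / 4] there, [Psi] stays below [M + d / 2 < u p]. *)
pose G' := G `&` [set z | u z < M + d / 4].
have oG' : open G'.
  by move/(continuous_inP _ oG): cu => /(_ [set t | t < M + d / 4]); apply; exact: open_lt.
have [|k2 k20 hk2] := compact_open_tube (cK _ cS) oG'.
  move=> _ [s Ss <-]; split; first by apply: GD; rewrite Ss.
  by rewrite /=; have := uM _ _ Ss; rewrite /f; lra.
pose k := Num.min k1 k2; have k0 : 0 < k by rewrite lt_min k10.
have kk1 : k <= k1 by rewrite ge_min lexx.
have kk2 : k <= k2 by rewrite ge_min lexx orbT.
pose T := D `*` [set y : 'C[R]_n | enorm y <= k].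
have cT : compact T by apply: compact_setX => //; exact: compact_enorm_le.
have T00 : T (0, 0).
  split; last by rewrite /= enorm0 ltW.
  by rewrite /D /= expr0n addr0 sqr_ge0.
have T0 : T !=set0 by exists (0, 0).
pose U := fun q : (R * R) * 'C[R]_n => u (f q.1 + q.2).
have cU q : T q -> {for q, continuous U}.
  move=> [Dq kq]; apply: (@continuous_comp _ _ _ (fun q => f q.1 + q.2) u).
    apply: cvgD; last exact: cvg_snd.
    by apply: (@continuous_comp _ _ _ fst f); [exact: cvg_fst|exact: cf].
  apply: cu; rewrite inE; apply: hk1; first by exists q.1.
  exact: le_trans kq kk1.
have [q0 Tq0 hq0] := continuous_compact_max T0 cT cU.
pose L := U q0.
(* On [|y| = k] the penalty [N k^2] exceeds the maximum [L] of [U] by enough to leave [Psi] below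
   [u p]. *)
pose N := (`|L| + `|u p| + d + 1) / k ^+ 2.
have k20' : 0 < k ^+ 2 by rewrite exprn_gt0.
have N0 : 0 < N.
  rewrite divr_gt0 //; have := normr_ge0 L; have := normr_ge0 (u p); lra.
have r20 : 0 < r ^+ 2 by rewrite exprn_gt0.
pose eta := d / (4 * r ^+ 2).
have eta0 : 0 < eta by rewrite divr_gt0 // mulr_gt0.
have etar : eta * r ^+ 2 = d / 4.
  by rewrite /eta; field; rewrite gt_eqF.
pose Psi := fun q : (R * R) * 'C[R]_n =>
  U q - N * dot q.2 q.2 + eta * (q.1.1 ^+ 2 + q.1.2 ^+ 2).
have cPsi q : T q -> {for q, continuous Psi}.
  move=> Tq; have c1 : (fun q : (R * R) * 'C[R]_n => q.1.1) @ q --> q.1.1.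
    by apply: (@continuous_comp _ _ _ fst fst); exact: cvg_fst.
  have c2 : (fun q : (R * R) * 'C[R]_n => q.1.2) @ q --> q.1.2.
    by apply: (@continuous_comp _ _ _ fst snd); [exact: cvg_fst|exact: cvg_snd].
  have c3 : (fun q : (R * R) * 'C[R]_n => dot q.2 q.2) @ q --> dot q.2 q.2.
    apply: (@continuous_comp _ _ _ (fun q : (R * R) * 'C[R]_n => (q.2, q.2))
      (fun q : 'C[R]_n * 'C[R]_n => dot q.1 q.2)); last exact: dot_continuous.
    exact: (cvg_pair cvg_snd cvg_snd).
  exact: (cvgD (cvgB (cU _ Tq) (cvgM (cvg_cst _) c3))
    (cvgM (cvg_cst _) (cvgD (cvg_sqr c1) (cvg_sqr c2)))).
have [[[a b] y] [/= Dab ky] hmax] := continuous_compact_max T0 cT cPsi.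
rewrite /= in Dab ky hmax.
have up : u p <= Psi ((a, b), y).
  apply: le_trans (hmax _ T00).
  rewrite /Psi /U /f /= p0 addr0 -sqr_enorm enorm0 expr0n /=; lra.
have dy : dot y y = enorm y ^+ 2 by rewrite sqr_enorm.
have ab_lt : a ^+ 2 + b ^+ 2 < r ^+ 2.
  rewrite lt_neqAle Dab andbT; apply/eqP => abr.
  have [_ /=] : G' (f (a, b) + y).
    by apply: hk2; [exists (a, b)|exact: le_trans ky kk2].
  move: up; rewrite /Psi /U /= abr etar.
  have := mulr_ge0 (ltW N0) (dot_ge0 y); rewrite /d; lra.
have y_lt : enorm y < k.
  rewrite lt_neqAle ky andbT; apply/eqP => yk.
  have UL : U ((a, b), y) <= L by apply: hq0; split.
  have Nk : N * dot y y = `|L| + `|u p| + d + 1.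
    by rewrite dy yk /N divfK // gt_eqF.
  move: up; rewrite /Psi Nk /=.
  have : eta * (a ^+ 2 + b ^+ 2) <= d / 4 by rewrite -etar ler_wpM2l // ltW.
  have := ler_norm L; have := ler_norm (- u p); rewrite normrN; lra.
have [t1 t10 ht1] := near_disc ab_lt.
(* The 1 keeps the denominators positive. The bound [t2] keeps [y - t^2 s^2 B] inside the tube, and
   [t3] makes the penalty error [N t^4 |B|^2] at most half of the gain [eta t^2]. *)
pose dB := enorm B + 1; have dB0 : 0 < dB by rewrite /dB ltr_wpDl ?enorm_ge0 ?ltr01.
pose t2 := (k - enorm y) / dB.
have t20 : 0 < t2 by rewrite divr_gt0 ?subr_gt0.
pose t3 := eta / (2 * N * dB ^+ 2).
have t30 : 0 < t3.
  by apply: divr_gt0 => //; apply: mulr_gt0; [exact: mulr_gt0|exact: exprn_gt0].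
pose t := Num.min (Num.min 1 t1) (Num.min t2 t3).
have t0 : 0 < t by rewrite !lt_min ltr01 t10 t20 t30.
have /and4P[tt0 tt1 tt2 tt3] : [&& t <= 1, t <= t1, t <= t2 & t <= t3].
  by rewrite /t !ge_min !lexx !orbT.
pose w := t *: (A + 2 *: cmul a b B).
pose z := f (a, b) + y.
have zw x1 x2 : z + cmul x1 x2 w = f (a + t * x1, b + t * x2) +
    (y - cmul (t ^+ 2 * (x1 ^+ 2 - x2 ^+ 2)) (t ^+ 2 * (2 * x1 * x2)) B).
  by rewrite /z /w /f /qdisc /=; vring.
have Tx x1 x2 : x1 ^+ 2 + x2 ^+ 2 <= 1 -> T ((a + t * x1, b + t * x2),
    y - cmul (t ^+ 2 * (x1 ^+ 2 - x2 ^+ 2)) (t ^+ 2 * (2 * x1 * x2)) B).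
  move=> x12; split; first by apply: (ht1 t x1 x2) => //; rewrite ltW.
  rewrite /=; apply: (le_trans (enormD _ _)); rewrite enormN enorm_cmul.
  set e := (X in Num.sqrt X); have eE : e = (t ^+ 2 * (x1 ^+ 2 + x2 ^+ 2)) ^+ 2.
    by rewrite /e; ring.
  have x0 : 0 <= x1 ^+ 2 + x2 ^+ 2 by rewrite addr_ge0 ?sqr_ge0.
  have e0 : 0 <= t ^+ 2 * (x1 ^+ 2 + x2 ^+ 2) by rewrite mulr_ge0 ?sqr_ge0.
  rewrite eE sqrtr_sqr ger0_norm //.
  move: tt2; rewrite ler_pdivlMr // => tt2.
  have e1 : t ^+ 2 * (x1 ^+ 2 + x2 ^+ 2) <= t by nra.
  have := ler_wpM2r (enorm_ge0 B) e1; rewrite /dB in tt2; lra.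
have Gw x1 x2 : x1 ^+ 2 + x2 ^+ 2 <= 1 -> G (z + cmul x1 x2 w).
  move=> x12; rewrite zw; have [/= D1 k3] := Tx _ _ x12.
  by apply: hk1; [eexists; [exact: D1|]|exact: le_trans k3 kk1].
have := hu _ _ Gw; apply/negP; rewrite -ltNge.
pose P := Psi ((a, b), y).
(* Maximality of [Psi] bounds [u] on the affine circle about [z] by the trigonometric polynomial
   [h], whose mean is [K = u z + N t^4 |B|^2 - eta t^2], smaller than [u z]. *)
pose K := P + N * dot y y + N * t ^+ 4 * dot B B
          - eta * (a ^+ 2 + b ^+ 2 + t ^+ 2).
pose h := fun th : R => K +
  (- 2 * eta * a * t * cos th + - 2 * eta * b * t * sin th) +
  (- 2 * N * t ^+ 2 * dot y B * (cos th ^+ 2 - sin th ^+ 2) +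
   - 2 * N * t ^+ 2 * dot y (cmul 0 1 B) * (2 * cos th * sin th)).
have ch : continuous h.
  move=> th; have cc := @continuous_cos R th; have ss := @continuous_sin R th.
  exact: (cvgD (cvgD (cvg_cst _) (cvgD (cvgM (cvg_cst _) cc) (cvgM (cvg_cst _) ss)))
    (cvgD (cvgM (cvg_cst _) (cvgB (cvg_sqr cc) (cvg_sqr ss)))
       (cvgM (cvg_cst _) (cvgM (cvgM (cvg_cst _) cc) ss)))).
have uh th : u (z + cmul (cos th) (sin th) w) <= h th.
  have cs := cos2Dsin2 th.
  have T1 : T ((a + t * cos th, b + t * sin th),
    y - cmul (t ^+ 2 * (cos th ^+ 2 - sin th ^+ 2))
             (t ^+ 2 * (2 * cos th * sin th)) B) by apply: Tx; rewrite cs.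
  have := hmax _ T1; rewrite -/P {1}/Psi /U /= -zw dot_sub_cmul.
  set c := cos th in cs *; set s := sin th in cs *.
  have -> : (a + t * c) ^+ 2 + (b + t * s) ^+ 2 =
      a ^+ 2 + b ^+ 2 + 2 * t * (a * c + b * s) + t ^+ 2.
    transitivity (a ^+ 2 + b ^+ 2 + 2 * t * (a * c + b * s)
      + t ^+ 2 * (c ^+ 2 + s ^+ 2)); first by ring.
    by rewrite cs mulr1.
  have -> : (t ^+ 2 * (c ^+ 2 - s ^+ 2)) ^+ 2 + (t ^+ 2 * (2 * c * s)) ^+ 2 = t ^+ 4.
    transitivity (t ^+ 4 * (c ^+ 2 + s ^+ 2) ^+ 2); first by ring.
    by rewrite cs expr1n mulr1.
  rewrite /h /K -/c -/s; lra.
have cuz := circle_comp_continuous cu Gw.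
apply: le_lt_trans (le_cint cuz ch uh) _.
rewrite cint_trig2 ltr_pM2l ?mulr_gt0 ?pi_gt0 //.
rewrite /K /P /Psi /U /= -/z.
suff : N * t ^+ 4 * dot B B < eta * t ^+ 2 by lra.
have -> : N * t ^+ 4 * dot B B = t ^+ 2 * (N * dot B B * t ^+ 2) by ring.
have t2p : 0 < t ^+ 2 by rewrite exprn_gt0.
rewrite [ltRHS]mulrC ltr_pM2l //.
have dBB : dot B B <= dB ^+ 2.
  by rewrite -sqr_enorm /dB; have := enorm_ge0 B; nra.
have tt : t ^+ 2 <= t3.
  by rewrite expr2; apply: le_trans tt3; rewrite ler_piMr // ltW.
have : N * dot B B * t ^+ 2 <= N * dB ^+ 2 * t3.
  apply: ler_pM tt; first by rewrite mulr_ge0 ?dot_ge0 // ltW.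
    by rewrite sqr_ge0.
  by rewrite ler_pM2l.
have -> : N * dB ^+ 2 * t3 = eta / 2.
  by rewrite /t3; field; rewrite !gt_eqF.
lra.
Qed.

End MaximumPrinciple.

(** * The continuity principle *)

Section DiscViolation.
Context {R : realType} {n : nat}.
Implicit Types (z A B N : 'C[R]_n) (W : set 'C[R]_n).

(* The configuration excluded by the continuity principle when [z] is outside
   [W]: only the centre [z] of the unpushed disc may leave [W]. *)
Definition pushed_disc W z : Prop :=
  exists A B N (r s0 : R), [/\ 0 < r, 0 < s0 &
    forall a b s : R, a ^+ 2 + b ^+ 2 <= r ^+ 2 -> 0 <= s <= s0 ->
      ~ [/\ a = 0, b = 0 & s = 0] -> W (qdisc (z + s *: N) A B a b)].

(** The boundary circles of all pushed discs, including the unpushed one, form a compact subset of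
    the domain of the exhaustion [u], so [u <= M] there. For [s > 0] the maximum principle puts the
    centre [z + s N] in the sublevel set of [M]. That set is compact, hence closed, so the limit [z]
    would lie in [W]. *)
Lemma locally_pseudoconvex_no_pushed_disc W z :
  ~ W z -> locally_pseudoconvex_at W z -> ~ pushed_disc W z.
Proof.
move=> Wz [rho rho0 [oG [u [cu pu cpt]]]] [A [B [N [r1 [s1 [r10 s10 hW]]]]]].
pose F := fun q : R * (R * R) => qdisc (z + q.1 *: N) A B q.2.1 q.2.2.
have FE : F = fun q => qdisc z A B q.2.1 q.2.2 + q.1 *: N.
  by apply/funext => q; rewrite /F /qdisc; vring.
have cF : continuous F.
  rewrite FE => q; apply: cvgD; last by apply: cvgZr_tmp; exact: cvg_fst.
  apply: (@continuous_comp _ _ _ snd (fun s : R * R => qdisc z A B s.1 s.2)).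
    exact: cvg_snd.
  exact: qdisc_continuous.
have F0 : F (0, (0, 0)) = z by rewrite /F /qdisc /=; vring.
have /nbhs_ballP[d d0 hd] : nbhs (0 : R, (0 : R, 0 : R)) (F @^-1` eball z rho).
  by apply: cF; rewrite F0; exact: nbhs_eball.
pose r := Num.min r1 (d / 2); pose s0 := Num.min s1 (d / 2).
have d20 : 0 < d / 2 by rewrite divr_gt0.
have r0 : 0 < r by rewrite lt_min r10.
have s00 : 0 < s0 by rewrite lt_min s10.
have [rr1 rd] : r <= r1 /\ r <= d / 2 by split; rewrite ge_min lexx ?orbT.
have [ss1 sd] : s0 <= s1 /\ s0 <= d / 2 by split; rewrite ge_min lexx ?orbT.
have d2 : d / 2 < d by rewrite ltr_pdivrMr // ltr_pMr // ltr1n.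
have hG (a b s : R) : a ^+ 2 + b ^+ 2 <= r ^+ 2 -> 0 <= s <= s0 ->
    ~ [/\ a = 0, b = 0 & s = 0] -> (eball z rho `&` W) (F (s, (a, b))).
  move=> ab /andP[sp ss] nz.
  have lt1 (x : R) : x ^+ 2 <= r ^+ 2 -> `|x| < d.
    move=> h; apply: le_lt_trans d2; apply: le_trans rd.
    by rewrite -(gtr0_norm r0) -!sqrtr_sqr ler_wsqrtr.
  split; last first.
    apply: hW => //; last by rewrite sp (le_trans ss).
    by apply: (le_trans ab); rewrite ler_pXn2r ?nnegrE ?(ltW r0) ?(ltW r10).
  apply: hd; split; rewrite /= /ball /= ?sub0r ?normrN.
    by rewrite ger0_norm //; apply: le_lt_trans d2; exact: le_trans ss sd.
  split; rewrite /= /ball /= ?sub0r ?normrN; apply: lt1.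
    by have := sqr_ge0 b; lra.
  by have := sqr_ge0 a; lra.
pose S := `[0, s0] `*` [set s : R * R | s.1 ^+ 2 + s.2 ^+ 2 = r ^+ 2].
have cS : compact S.
  by apply: compact_setX; [exact: segment_compact|exact: compact_circle].
have SG q : S q -> (eball z rho `&` W) (F q).
  case: q => s [a b] [/= + ab]; rewrite in_itv /= => hs.
  apply: hG; rewrite ?ab // => -[a0 b0 _].
  by move: ab; rewrite a0 b0 expr0n addr0 => /esym/eqP; rewrite expf_eq0 /= gt_eqF.
have S0 : S !=set0.
  exists (0, (r, 0)); split; rewrite /= ?in_itv /= ?lexx ?(ltW s00) //.
  by rewrite expr0n addr0.
have [|q Sq hq] := continuous_compact_max S0 cS (f := u \o F).
  move=> q Sq; apply: continuous_comp; first exact: cF.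
  by apply: cu; rewrite inE; exact: SG.
pose M := u (F q).
have key (s : R) : 0 < s <= s0 ->
    ((eball z rho `&` W) `&` [set w | u w <= M]) (z + s *: N).
  move=> /andP[sp ss].
  have Fs : F (s, (0, 0)) = z + s *: N by rewrite /F /qdisc /=; vring.
  have nz (a b : R) : ~ [/\ a = 0, b = 0 & s = 0].
    by case=> _ _ s00'; rewrite s00' ltxx in sp.
  have hs : 0 <= s <= s0 by rewrite ltW.
  split; first by rewrite -Fs; apply: hG; rewrite // expr0n addr0 sqr_ge0.
  apply: (disc_max_principle (A := A) (B := B) oG cu pu r0) => a b ab.
    exact: (hG a b s ab hs (nz a b)).
  by apply: (hq (s, (a, b))); split; rewrite /= ?in_itv.
have clo := compact_closed (@norm_hausdorff _ _) (cpt M).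
have [[_ Wz'] _] : ((eball z rho `&` W) `&` [set w | u w <= M]) z; last exact: Wz.
apply: clo => U /nbhs_eballP[e e0 eU].
pose m := enorm N + 1; have m0 : 0 < m by rewrite /m ltr_wpDl ?enorm_ge0 ?ltr01.
pose s := Num.min s0 (e / m).
have sp : 0 < s by rewrite lt_min s00 divr_gt0.
have se : s * m <= e by rewrite -ler_pdivlMr // ge_min lexx orbT.
exists (z + s *: N); split; first by apply: key; rewrite sp ge_min lexx.
apply: eU; rewrite /eball /= addrAC subrr add0r enormZ gtr0_norm //.
rewrite /m in se; nra.
Qed.

End DiscViolation.

(** * Harmonic majorants on the disc *)

Import Normc.

Section HarmonicPolynomials.
Context {R : realType}.
Implicit Types (h g k : R -> R) (H : R -> R -> R).

Lemma normcD (x y : R[i]) : normc (x + y) <= normc x + normc y.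
Proof. exact: le_normcD. Qed.

Lemma normc_ge0 (x : R[i]) : 0 <= normc x.
Proof. by case: x => a b; exact: sqrtr_ge0. Qed.

Lemma normcX (x : R[i]) m : normc (x ^+ m) = normc x ^+ m.
Proof. by elim: m => [|m IH]; rewrite ?expr0 ?normc1 // !exprS normcM IH. Qed.

Lemma expr_taylor2 m (t : R[i]) : exists (b c : R[i]) (M : R), 0 <= M /\
  forall s, normc s <= 1 ->
    normc ((t + s) ^+ m - (t ^+ m + b * s + c * s ^+ 2)) <= M * normc s ^+ 3.
Proof.
elim: m => [|m [b [c [M [M0 hM]]]]].
  exists 0, 0, 0; split => // s _.
  by rewrite !expr0 !mul0r !addr0 subrr normc0.
(* Coefficients of the previous expansion multiplied by [t + s]; the term [c s^3] joins the
   remainder. *)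
exists (t ^+ m + t * b), (b + t * c), ((normc t + 1) * M + normc c); split.
  by rewrite addr_ge0 ?mulr_ge0 ?addr_ge0 ?normc_ge0.
move=> s s1; have {hM} := hM s s1; set E := _ - _ => hE.
rewrite (_ : _ - _ = (t + s) * E + c * s ^+ 3); last first.
  by rewrite /E !exprS; ring.
apply: le_trans (normcD _ _) _; rewrite [leRHS]mulrDl; apply: lerD; last first.
  by rewrite normcM normcX.
rewrite normcM -mulrA; apply: ler_pM; rewrite ?normc_ge0 //.
by apply: le_trans (normcD _ _) _; rewrite lerD2l.
Qed.

(* The quadratic part of each expansion has zero Laplacian: this is all that is
   needed of harmonicity. *)
Definition harmonic2 H : Prop :=
  continuous (fun p : R * R => H p.1 p.2) /\
  forall x y : R, exists b1 b2 c1 c2 M : R, 0 <= M /\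
    forall a b : R, a ^+ 2 + b ^+ 2 <= 1 ->
    `|H (x + a) (y + b) - (H x y + (b1 * a + b2 * b)
       + (c1 * (a ^+ 2 - b ^+ 2) + c2 * (2 * a * b)))|
      <= M * Num.sqrt (a ^+ 2 + b ^+ 2) ^+ 3.

Lemma harmonic2D H1 H2 : harmonic2 H1 -> harmonic2 H2 ->
  harmonic2 (fun x y => H1 x y + H2 x y).
Proof.
move=> [C1 T1] [C2 T2]; split; first by move=> p; apply: cvgD; [exact: C1|exact: C2].
move=> x y; have [b1 [b2 [c1 [c2 [M [M0 h]]]]]] := T1 x y.
have [b1' [b2' [c1' [c2' [M' [M0' h']]]]]] := T2 x y.
exists (b1 + b1'), (b2 + b2'), (c1 + c1'), (c2 + c2'), (M + M').
split; first exact: addr_ge0.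
move=> a b ab; rewrite [leRHS]mulrDl; apply: (le_trans _ (lerD (h a b ab) (h' a b ab))).
apply: (le_trans _ (ler_normD _ _)); rewrite le_eqVlt; apply/orP; left; apply/eqP.
by congr `|_|; ring.
Qed.

Lemma harmonic2Z (e : R) H : harmonic2 H -> harmonic2 (fun x y => e * H x y).
Proof.
move=> [C1 T1]; split; first by move=> p; apply: cvgM; [exact: cvg_cst|exact: C1].
move=> x y; have [b1 [b2 [c1 [c2 [M [M0 h]]]]]] := T1 x y.
exists (e * b1), (e * b2), (e * c1), (e * c2), (`|e| * M).
split; first exact: mulr_ge0.
move=> a b ab; rewrite -[leRHS]mulrA; apply: (le_trans _ (ler_wpM2l (normr_ge0 e) (h a b ab))).
rewrite -normrM le_eqVlt; apply/orP; left; apply/eqP; congr `|_|; ring.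
Qed.

Lemma Re_normc (x : R[i]) : `|complex.Re x| <= normc x.
Proof.
by case: x => a b /=; rewrite -sqrtr_sqr ler_wsqrtr // lerDl sqr_ge0.
Qed.

Lemma Im_normc (x : R[i]) : `|complex.Im x| <= normc x.
Proof.
by case: x => a b /=; rewrite -sqrtr_sqr ler_wsqrtr // lerDr sqr_ge0.
Qed.

Lemma harmonic2_expr m :
  harmonic2 (fun x y => complex.Re ((x +i* y)%C ^+ m)) /\
  harmonic2 (fun x y => complex.Im ((x +i* y)%C ^+ m)).
Proof.
have [cR cI] : continuous (fun p : R * R => complex.Re ((p.1 +i* p.2)%C ^+ m)) /\
    continuous (fun p : R * R => complex.Im ((p.1 +i* p.2)%C ^+ m)).
  elim: m => [|m [cR cI]]; first by split => p; exact: cvg_cst.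
  have E (p : R * R) : ((p.1 +i* p.2)%C ^+ m.+1) =
      ((p.1 * complex.Re ((p.1 +i* p.2)%C ^+ m)
        - p.2 * complex.Im ((p.1 +i* p.2)%C ^+ m)) +i*
      (p.1 * complex.Im ((p.1 +i* p.2)%C ^+ m)
        + p.2 * complex.Re ((p.1 +i* p.2)%C ^+ m)))%C.
    by rewrite exprS; case: (_ ^+ m).
  split=> p; under eq_fun do rewrite E /=;
    have c1 : fst @ p --> p.1 by exact: cvg_fst.
    have c2 : snd @ p --> p.2 by exact: cvg_snd.
    exact: (cvgB (cvgM c1 (cR p)) (cvgM c2 (cI p))).
  have c2 : snd @ p --> p.2 by exact: cvg_snd.
  exact: (cvgD (cvgM c1 (cI p)) (cvgM c2 (cR p))).
have nc (a b : R) : normc (a +i* b)%C = Num.sqrt (a ^+ 2 + b ^+ 2) by [].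
have n1 (a b : R) : a ^+ 2 + b ^+ 2 <= 1 -> normc (a +i* b)%C <= 1.
  by move=> h; rewrite nc; apply: (le_trans (ler_wsqrtr h)); rewrite sqrtr1.
split; split => // x y.
- have [[b1 b2] [[c1 c2] [M [M0 hM]]]] := expr_taylor2 m (x +i* y)%C.
  exists b1, (- b2), c1, (- c2), M; split => // a b /n1 /hM; rewrite nc.
  apply: le_trans; apply: le_trans (Re_normc _).
  rewrite (_ : ((x + a) +i* (y + b))%C = (x +i* y)%C + (a +i* b)%C) //.
  rewrite !raddfB !raddfD /= le_eqVlt; apply/orP; left; apply/eqP; congr `|_|.
  by ring.
- have [[b1 b2] [[c1 c2] [M [M0 hM]]]] := expr_taylor2 m (x +i* y)%C.
  exists b2, b1, c2, c1, M; split => // a b /n1 /hM; rewrite nc.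
  apply: le_trans; apply: le_trans (Im_normc _).
  rewrite (_ : ((x + a) +i* (y + b))%C = (x +i* y)%C + (a +i* b)%C) //.
  rewrite !raddfB !raddfD /= le_eqVlt; apply/orP; left; apply/eqP; congr `|_|.
  by ring.
Qed.

Lemma harmonic2_cst (e : R) : harmonic2 (fun _ _ => e).
Proof.
have := harmonic2Z e (harmonic2_expr 0).1.
by under [X in harmonic2 X]eq_fun do (under eq_fun do rewrite expr0 /= mulr1).
Qed.

Lemma de_moivre m (t : R) :
  (cos t +i* sin t)%C ^+ m = (cos (m%:R * t) +i* sin (m%:R * t))%C.
Proof.
elim: m => [|m IH]; first by rewrite expr0 mul0r cos0 sin0.
by rewrite exprS IH -natr1 mulrDl mul1r cosD sinD; congr Complex; ring.
Qed.

Fixpoint dirichlet (m : nat) (x : R) : R :=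
  if m is m'.+1 then dirichlet m' x + 2 * cos (m%:R * x) else 1.

(** The Fejer kernel without its factor [1 / m]: the integral over the circle is [2 pi m]. *)
Fixpoint fejer (m : nat) (x : R) : R :=
  if m is m'.+1 then fejer m' x + dirichlet m' x else 0.

(** Multiplication by [1 - cos x] makes the sum telescope, here and in [fejerE]. The same weight
    measures the oscillation of [g] in [harmonic_circle_majorant], which replaces any estimate on
    the concentration of the kernel. *)
Lemma dirichletE m (x : R) :
  (1 - cos x) * dirichlet m x = cos (m%:R * x) - cos (m.+1%:R * x).
Proof.
elim: m => [|m IH]; first by rewrite /= mul0r cos0 mul1r; ring.
rewrite /= mulrDr IH.
have -> : m.+2%:R * x = m.+1%:R * x + x by rewrite -[m.+2]addn1 natrD; ring.
have -> : cos (m%:R * x) = cos (m.+1%:R * x) * cos x + sin (m.+1%:R * x) * sin x.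
  by rewrite -cosB; congr cos; rewrite -natr1; ring.
rewrite cosD; ring.
Qed.

Lemma fejerE m (x : R) : (1 - cos x) * fejer m x = 1 - cos (m%:R * x).
Proof.
elim: m => [|m IH]; first by rewrite /= mul0r cos0 mulr0 subrr.
rewrite /= mulrDr IH dirichletE; ring.
Qed.

Lemma fejer_ge0 m (x : R) : 0 <= fejer m x.
Proof.
have [c1|c1] := eqVneq (cos x) 1; last first.
  have c0 : 0 < 1 - cos x by rewrite subr_gt0 lt_neqAle c1 cos_le1.
  by rewrite -(pmulr_rge0 _ c0) fejerE subr_ge0 cos_le1.
have s0 : sin x = 0.
  by have := cos2Dsin2 x; rewrite c1 expr1n => h; apply/eqP; rewrite -sqrf_eq0; apply/eqP; lra.
have ck j : cos (j%:R * x) = 1 /\ sin (j%:R * x) = 0.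
  elim: j => [|j [c s]]; first by rewrite mul0r cos0 sin0.
  by rewrite -natr1 mulrDl mul1r cosD sinD c s c1 s0; split; ring.
have d j : 0 <= dirichlet j x.
  by elim: j => [|j IH] //=; rewrite (ck j.+1).1; lra.
by elim: m => [|m IH] //=; rewrite addr_ge0.
Qed.

(** The harmonic extension of the convolution is bundled with the kernel because all three
    properties are additive in [k]; the Fejer kernel can then be treated one cosine at a time. *)
Definition harmonic_kernel g k (c : R) : Prop :=
  [/\ continuous k, forall t, cint (fun s => k (t - s)) = 2 * pi * c
   & exists2 H, harmonic2 H &
      (forall t, H (cos t) (sin t) = cint (fun s => g s * k (t - s))) /\
      H 0 0 = c * cint g].

Lemma kernel_shift_continuous k (t : R) : continuous k ->
  continuous (fun s => k (t - s)).
Proof.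
move=> ck s; apply: (@continuous_comp _ _ _ (fun s => t - s) k); last exact: ck.
by apply: cvgB; [exact: cvg_cst|exact: cvg_id].
Qed.

Lemma mul_continuous g k : continuous g -> continuous k ->
  continuous (fun s => g s * k s).
Proof. by move=> cg ck s; apply: cvgM; [exact: cg|exact: ck]. Qed.

Lemma harmonic_kernelD g k1 k2 (c1 c2 : R) : continuous g ->
  harmonic_kernel g k1 c1 -> harmonic_kernel g k2 c2 ->
  harmonic_kernel g (fun x => k1 x + k2 x) (c1 + c2).
Proof.
move=> cg [ck1 m1 [H1 h1 [e1 o1]]] [ck2 m2 [H2 h2 [e2 o2]]]; split.
- by move=> x; apply: cvgD; [exact: ck1|exact: ck2].
- move=> t; rewrite cintD; [|exact: kernel_shift_continuous..].
  by rewrite m1 m2; ring.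
- exists (fun x y => H1 x y + H2 x y); first exact: harmonic2D.
  split=> [t|]; last by rewrite o1 o2 mulrDl.
  rewrite e1 e2 -cintD; try by apply: mul_continuous => //; exact: kernel_shift_continuous.
  by congr cint; apply/funext => s; rewrite mulrDr.
Qed.

Lemma harmonic_kernel1 g : continuous g -> harmonic_kernel g (fun=> 1) 1.
Proof.
move=> cg; split; first by move=> x; exact: cvg_cst.
  by move=> t; rewrite cint_cst.
exists (fun _ _ => cint g); first exact: harmonic2_cst.
split=> [t|]; last by rewrite mul1r.
by congr cint; apply/funext => s; rewrite mulr1.
Qed.

(** The addition formula reduces the convolution to the [m]-th Fourier coefficients of [g], and de
    Moivre extends [cos (m t)] and [sin (m t)] as the real and imaginary parts of [(x + i y)^m]. *)
Lemma harmonic_kernel_cos g m : (0 < m)%N -> continuous g ->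
  harmonic_kernel g (fun x => 2 * cos (m%:R * x)) 0.
Proof.
move=> m0 cg.
have cc : continuous (fun s : R => cos (m%:R * s)) by exact: cos_mul_continuous.
have cs : continuous (fun s : R => sin (m%:R * s)) by exact: sin_mul_continuous.
have scale (e : R) (f : R -> R) : continuous f -> continuous (fun s => e * f s).
  by move=> cf s; apply: cvgM; [exact: cvg_cst|exact: cf].
have E (t s : R) : 2 * cos (m%:R * (t - s)) =
    2 * cos (m%:R * t) * cos (m%:R * s) + 2 * sin (m%:R * t) * sin (m%:R * s).
  by rewrite mulrBr cosB; ring.
split.
- exact: (scale 2 _ cc).
- move=> t; under [X in cint X]eq_fun do rewrite E.
  rewrite cintD; [|exact: scale..].
  by rewrite !cintZ // cint_cos // cint_sin // !mulr0 addr0.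
- exists (fun x y => 2 * cint (fun s => g s * cos (m%:R * s)) *
     complex.Re ((x +i* y)%C ^+ m) + 2 * cint (fun s => g s * sin (m%:R * s)) *
     complex.Im ((x +i* y)%C ^+ m)).
    by apply: harmonic2D; apply: harmonic2Z; have [] := harmonic2_expr m.
  split=> [t|]; last by rewrite mul0r expr0n gtn_eqF //= !mulr0 addr0.
  rewrite de_moivre /=.
  have gc : continuous (fun s => g s * cos (m%:R * s)) by exact: mul_continuous.
  have gs : continuous (fun s => g s * sin (m%:R * s)) by exact: mul_continuous.
  transitivity (cint (fun s => 2 * cos (m%:R * t) * (g s * cos (m%:R * s)) +
      2 * sin (m%:R * t) * (g s * sin (m%:R * s)))).
    by rewrite cintD; [|exact: scale..]; rewrite !cintZ //; ring.
  by congr cint; apply/funext => s; rewrite E; ring.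
Qed.

Lemma harmonic_kernel_fejer g m : continuous g ->
  harmonic_kernel g (fejer m) m%:R.
Proof.
move=> cg; elim: m => [|m IH].
  split; first by move=> x; exact: cvg_cst.
    by move=> t; rewrite cint_cst.
  exists (fun _ _ => 0); first exact: harmonic2_cst.
  split=> [t|]; last by rewrite mul0r.
  by under [X in cint X]eq_fun do rewrite /= mulr0; rewrite cint_cst mulr0.
rewrite -natr1; apply: harmonic_kernelD => //.
elim: m {IH} => [|m IH]; first exact: harmonic_kernel1.
by rewrite -[1]addr0; apply: harmonic_kernelD => //; exact: harmonic_kernel_cos.
Qed.

(** Integrating the lower bound for [g] against the nonnegative Fejer kernel, [fejerE] turns
    [L (1 - cos)] times the kernel into [L (1 - cos (m x)) <= 2 L]. After division by [m] this costs
    [2 L / m], which is at most [e] by the choice of [m]. *)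
Lemma harmonic_circle_majorant g (e L : R) : continuous g -> 0 < e -> 0 <= L ->
    (forall s t, g t - e - L * (1 - cos (t - s)) <= g s) ->
  exists2 H, harmonic2 H &
    (forall t, 2 * pi * (g t - 2 * e) <= H (cos t) (sin t)) /\ H 0 0 = cint g.
Proof.
move=> cg e0 L0 hg; pose m := (Num.truncn (2 * L / e)).+1.
have mL : 2 * L / e <= m%:R.
  by apply/ltW; rewrite /m; exact: truncnS_gt.
have m0 : 0 < m%:R :> R by rewrite ltr0n.
have [ck mk [H hH [HE H0]]] := harmonic_kernel_fejer m cg.
exists (fun x y => m%:R^-1 * H x y); first exact: harmonic2Z.
split=> [t|]; last by rewrite H0 mulKf // gt_eqF.
rewrite ler_pdivlMl // HE.
have kc := @kernel_shift_continuous _ t ck.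
have : cint (fun s => (g t - e) * fejer m (t - s) + - (2 * L)) <=
       cint (fun s => g s * fejer m (t - s)).
  apply: le_cint.
  - move=> s; apply: cvgD; last exact: cvg_cst.
    by apply: cvgM; [exact: cvg_cst|exact: kc].
  - exact: mul_continuous.
  - move=> s; have f0 := fejer_ge0 m (t - s).
    apply: le_trans (ler_wpM2r f0 (hg s t)).
    rewrite [leRHS]mulrBl lerD2l lerN2 -mulrA fejerE mulrC.
    by rewrite ler_wpM2r //; have := cos_geN1 (m%:R * (t - s)); lra.
rewrite cintD; [|by move=> s; apply: cvgM; [exact: cvg_cst|exact: kc]|by move=> s; exact: cvg_cst].
rewrite cintZ // mk cint_cst; apply: le_trans.
have : 2 * L <= m%:R * e by rewrite -ler_pdivrMr.
have := @pi_gt0 R; nra.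
Qed.

End HarmonicPolynomials.

(** * Touching by strictly superharmonic quadratics *)

Lemma compact_superlevel (T : topologicalType) (R : realType) (K : set T)
    (f : T -> R) (c : R) : hausdorff_space T -> compact K ->
    (forall x, K x -> {for x, continuous f}) ->
  compact (K `&` [set x | c <= f x]).
Proof.
move=> hT cK cf; apply: (subclosed_compact _ cK); last by move=> x [].
move=> x clx.
have Kx : K x.
  apply: (compact_closed hT cK) => U Ux.
  by have [y [[Ky _] Uy]] := clx _ Ux; exists y.
split => //=; rewrite leNgt; apply/negP => fx.
have : \forall y \near x, f y < c by move/cvgr_lt: (cf x Kx); apply.
by move/clx => [y [[_ /= fy]]]; rewrite ltNge fy.
Qed.

Section Touching.
Context {R : realType}.
Implicit Types G : R * R -> R.

Lemma cos_sin_continuous : continuous (fun t : R => (cos t, sin t)).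
Proof. by move=> t; exact: (cvg_pair (@continuous_cos R t) (@continuous_sin R t)). Qed.

(** On the compact set of pairs where [G] drops by at least [e], half the squared chord, that is
    [1 - cos (t - s)], is bounded below by a positive constant, so a large multiple of it pays for
    the largest drop. *)
Lemma circle_modulus G (e : R) : 0 < e ->
    (forall p, p.1 ^+ 2 + p.2 ^+ 2 = 1 -> {for p, continuous G}) ->
  exists2 L : R, 0 <= L & forall s t,
    G (cos t, sin t) - e - L * (1 - cos (t - s)) <= G (cos s, sin s).
Proof.
move=> e0 cG; pose S := [set p : R * R | p.1 ^+ 2 + p.2 ^+ 2 = 1 ^+ 2].
have cS : compact (S `*` S) by apply: compact_setX; exact: compact_circle.
pose f := fun q : (R * R) * (R * R) => G q.1 - G q.2.
have cf q : (S `*` S) q -> {for q, continuous f}.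
  move=> [/= S1 S2]; rewrite /S /= expr1n in S1 S2.
  apply: cvgB; [apply: (@continuous_comp _ _ _ fst G)|apply: (@continuous_comp _ _ _ snd G)].
  - exact: cvg_fst.
  - exact: cG.
  - exact: cvg_snd.
  - exact: cG.
pose E := (S `*` S) `&` [set q | e <= f q].
have cE : compact E by apply: compact_superlevel => //; exact: norm_hausdorff.
have Sc t : S (cos t, sin t) by rewrite /S /= expr1n cos2Dsin2.
have [E0|/set0P E0] := eqVneq E set0.
  exists 0 => // s t; rewrite mul0r subr0 leNgt; apply/negP => h.
  suff : E ((cos t, sin t), (cos s, sin s)) by rewrite E0.
  by split; [split; exact: Sc|rewrite /= /f /=; lra].
pose d := fun q : (R * R) * (R * R) =>
  1 - (q.1.1 * q.2.1 + q.1.2 * q.2.2).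
have cd : continuous d.
  move=> q.
  have c1 : (fun q : (R * R) * (R * R) => q.1.1) @ q --> q.1.1.
    by apply: (@continuous_comp _ _ _ fst fst); exact: cvg_fst.
  have c2 : (fun q : (R * R) * (R * R) => q.1.2) @ q --> q.1.2.
    by apply: (@continuous_comp _ _ _ fst snd); [exact: cvg_fst|exact: cvg_snd].
  have c3 : (fun q : (R * R) * (R * R) => q.2.1) @ q --> q.2.1.
    by apply: (@continuous_comp _ _ _ snd fst); [exact: cvg_snd|exact: cvg_fst].
  have c4 : (fun q : (R * R) * (R * R) => q.2.2) @ q --> q.2.2.
    by apply: (@continuous_comp _ _ _ snd snd); exact: cvg_snd.
  exact: (cvgB (cvg_cst _) (cvgD (cvgM c1 c3) (cvgM c2 c4))).
have [|q0 Eq0 hq0] := continuous_compact_min E0 cE (f := d).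
  by move=> q _; exact: cd.
have [|q1 Eq1 hq1] := continuous_compact_max E0 cE (f := f).
  by move=> q [Sq _]; exact: cf.
have d0 : 0 < d q0.
  move: Eq0 => [[/= + +] /=]; case: (q0) => [[a b] [a' b']]; rewrite /S /f /d /= expr1n.
  move=> h1 h2 h3; rewrite ltNge; apply/negP => h4.
  have h5 : (a - a') ^+ 2 + (b - b') ^+ 2 <= 0 by nra.
  have [h6 h7] : a = a' /\ b = b'.
    have := sqr_ge0 (a - a'); have := sqr_ge0 (b - b') => k1 k2.
    split; apply/eqP; rewrite -subr_eq0 -sqrf_eq0; apply/eqP; lra.
  by rewrite h6 h7 subrr in h3; lra.
have f0 : 0 <= f q1 by have := Eq1.2; rewrite /=; lra.
exists (f q1 / d q0); first by rewrite divr_ge0 // ltW.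
move=> s t; have [h|h] := leP e (f ((cos t, sin t), (cos s, sin s))); last first.
  move: h; rewrite /f /= => h.
  have : 0 <= f q1 / d q0 * (1 - cos (t - s)).
    by rewrite mulr_ge0 ?divr_ge0 ?(ltW d0) // subr_ge0 cos_le1.
  by rewrite /f; lra.
have Eq : E ((cos t, sin t), (cos s, sin s)).
  by split => //; split; exact: Sc.
have := hq1 _ Eq; have := hq0 _ Eq; rewrite {2}/d {1}/f /= -cosB => h1 h2.
have : f q1 <= f q1 / d q0 * (1 - cos (t - s)).
  by rewrite -mulrA ler_peMr // ler_pdivlMl // mulr1.
lra.
Qed.

(* [2 pi G - H + e |p|^2], with [H] a harmonic majorant of [2 pi G] on the circle
   up to a small error, has an interior maximum on the disc. *)
Lemma disc_touching G :
    (forall p, p.1 ^+ 2 + p.2 ^+ 2 <= 1 -> {for p, continuous G}) ->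
    cint (fun t => G (cos t, sin t)) < 2 * pi * G (0, 0) ->
  exists x y b1 b2 c1 c2 e r : R, [/\ x ^+ 2 + y ^+ 2 <= 1, 0 < e, 0 < r &
    forall a b, a ^+ 2 + b ^+ 2 <= r ^+ 2 ->
      (x + a) ^+ 2 + (y + b) ^+ 2 <= 1 /\
      G (x + a, y + b) <= G (x, y) + (b1 * a + b2 * b)
        + (c1 * (a ^+ 2 - b ^+ 2) + c2 * (2 * a * b)) - e * (a ^+ 2 + b ^+ 2)].
Proof.
move=> cG hG; have p2 : 0 < 2 * pi :> R by rewrite mulr_gt0 ?pi_gt0.
pose d := 2 * pi * G (0, 0) - cint (fun t => G (cos t, sin t)).
have d0 : 0 < d by rewrite subr_gt0.
(* The majorant error is [2 pi * 2 e1 = d / 4], and [e] below is also [d / 4]. Hence [Phi <= d / 2]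
   on the circle, whereas [Phi = d] at the centre. *)
pose e1 := d / (16 * pi).
have e10 : 0 < e1 by rewrite divr_gt0 ?mulr_gt0 ?pi_gt0.
have [|L L0 hL] := circle_modulus (G := G) e10.
  by move=> p hp; apply: cG; rewrite hp.
have cg : continuous (fun t => G (cos t, sin t)).
  move=> t; apply: (@continuous_comp _ _ _ (fun t : R => (cos t, sin t)) G).
    exact: cos_sin_continuous.
  by apply: cG; rewrite /= cos2Dsin2.
have [H [cH tH] [H1 H0]] := harmonic_circle_majorant cg e10 L0 hL.
pose e := d / 4; have e0 : 0 < e by rewrite divr_gt0.
pose Phi := fun p : R * R =>
  2 * pi * G p - H p.1 p.2 + e * (p.1 ^+ 2 + p.2 ^+ 2).
pose D := [set p : R * R | p.1 ^+ 2 + p.2 ^+ 2 <= 1 ^+ 2].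
have cD : compact D := @compact_disc R 1.
have D00 : D (0, 0) by rewrite /D /= expr0n addr0 expr1n ler01.
have D0 : D !=set0 by exists (0, 0).
have [|[x y] Dxy hmax] := continuous_compact_max D0 cD (f := Phi).
  move=> p; rewrite /D /= expr1n => Dp.
  have c1 : fst @ p --> p.1 by exact: cvg_fst.
  have c2 : snd @ p --> p.2 by exact: cvg_snd.
  exact: (cvgD (cvgB (cvgM (cvg_cst _) (cG p Dp)) (cH p))
    (cvgM (cvg_cst _) (cvgD (cvg_sqr c1) (cvg_sqr c2)))).
have Pd : d <= Phi (x, y).
  apply: le_trans (hmax _ D00); rewrite /Phi /= H0 expr0n /d /=; lra.
have xy1 : x ^+ 2 + y ^+ 2 < 1 ^+ 2.
  rewrite lt_neqAle Dxy andbT expr1n; apply/eqP => xy.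
  have [t [xt yt]] : exists t : R, cos t = x /\ sin t = y.
    have x1 : -1 <= x <= 1.
      rewrite -ler_norml -sqrtr_sqr -[leRHS]sqrtr1 ler_wsqrtr //.
      by have := sqr_ge0 y; lra.
    have s1 : sin (acos x) ^+ 2 = y ^+ 2.
      by have := cos2Dsin2 (acos x); rewrite acosK //; lra.
    move/eqP: s1; rewrite eqf_sqr => /orP[/eqP s1|/eqP s1].
      by exists (acos x); rewrite acosK.
    by exists (- acos x); rewrite cosN sinN acosK // s1 opprK.
  have := H1 t; rewrite xt yt => h; move: Pd; rewrite /Phi /= xy mulr1 /e.
  have : 2 * pi * (2 * e1) = d / 4.
    by rewrite /e1; move: (@pi_gt0 R); move: pi => P P0; field; rewrite gt_eqF.
  lra.
have [t0 t00 ht] := near_disc xy1.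
have [b1 [b2 [c1 [c2 [M [M0 hM]]]]]] := tH x y.
pose m := 2 * M + 1; have m0 : 0 < m by rewrite /m; lra.
pose r := Num.min (Num.min 1 t0) (e / m).
have r0 : 0 < r by rewrite !lt_min ltr01 t00 divr_gt0.
have /and3P[r1 rt rm] : [&& r <= 1, r <= t0 & r <= e / m].
  by rewrite /r !ge_min !lexx !orbT.
pose q := (2 * pi)^-1 : R.
have q0 : 0 < q by rewrite invr_gt0.
(* Coefficients of [H - e |p|^2] at [(x, y)], divided by [2 pi]. Half of [e] is spent on the cubic
   remainder of [H]. *)
exists x, y, (q * (b1 - 2 * e * x)), (q * (b2 - 2 * e * y)), (q * c1), (q * c2),
  (q * (e / 2)), r; split; [by move: Dxy; rewrite /D /= expr1n|
  by apply: mulr_gt0 => //; apply: divr_gt0|by []|].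
move=> a b ab.
have Dab : (x + a) ^+ 2 + (y + b) ^+ 2 <= 1 ^+ 2.
  have := ht r (a / r) (b / r); rewrite !mulrA !(mulrC r) !mulfK ?gt_eqF //.
  apply; first by rewrite rt ltW.
  by rewrite !expr_div_n -mulrDl ler_pdivrMr ?exprn_gt0 // mul1r.
split; first by rewrite expr1n in Dab.
have := hmax (x + a, y + b) Dab; rewrite /Phi /=.
have ab1 : a ^+ 2 + b ^+ 2 <= 1.
  by apply: (le_trans ab); rewrite -(expr1n _ 2) ler_pXn2r // ?nnegrE ?ltW // ltW.
set s := a ^+ 2 + b ^+ 2 in ab ab1 *.
have s0 : 0 <= s by rewrite addr_ge0 ?sqr_ge0.
have := hM a b ab1; rewrite -/s ler_norml => /andP[_ hH].
have ss : Num.sqrt s ^+ 3 = s * Num.sqrt s by rewrite exprSr sqr_sqrtr.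
have sr : Num.sqrt s <= r.
  by rewrite -[leRHS](gtr0_norm r0) -sqrtr_sqr ler_wsqrtr.
have Ms : M * Num.sqrt s ^+ 3 <= e / 2 * s.
  have Mr : M * Num.sqrt s <= e / 2.
    apply: (@le_trans _ _ (M * (e / m))).
      by rewrite ler_wpM2l // (le_trans sr).
    rewrite mulrA ler_pdivrMr // /m; nra.
  by rewrite ss mulrCA mulrC ler_wpM2r.
move=> hP.
have key : 2 * pi * G (x + a, y + b) <= 2 * pi * G (x, y) +
   ((b1 - 2 * e * x) * a + (b2 - 2 * e * y) * b)
   + (c1 * (a ^+ 2 - b ^+ 2) + c2 * (2 * a * b)) - e / 2 * s.
  move: hP hH Ms; rewrite /s; lra.
rewrite -(ler_pM2l p2); apply: (le_trans key).
rewrite le_eqVlt; apply/orP; left; apply/eqP; rewrite /q.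
by move: (@pi_gt0 R); move: pi => P P0; field; rewrite gt_eqF.
Qed.

End Touching.

(** * Analytic discs touching the boundary *)

Section DistanceDisc.
Context {R : realType}.

Lemma normc_sqr (x : R[i]) : normc x ^+ 2 = complex.Re x ^+ 2 + complex.Im x ^+ 2.
Proof. by case: x => a b /=; rewrite sqr_sqrtr // addr_ge0 ?sqr_ge0. Qed.

(* With [f = 1 + beta s + gamma s^2] and [g] the second-order Taylor polynomial
   of [1 / f], [|g|^2 |f|^2 = 1 + O(|s|^3)]. *)
Lemma quadratic_reciprocal (beta gamma : R[i]) (eta : R) : 0 < eta ->
  exists2 r : R, 0 < r & forall s : R[i], normc s <= r ->
    let g := 1 - beta * s + (beta ^+ 2 - gamma) * s ^+ 2 in
    1 / 2 <= complex.Re g /\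
    normc g ^+ 2 * (1 + 2 * complex.Re (beta * s + gamma * s ^+ 2)
      - eta * normc s ^+ 2) <= 1 - eta / 8 * normc s ^+ 2.
Proof.
move=> eta0; pose kappa := beta ^+ 2 - gamma.
pose K := normc beta + normc kappa.
pose C := normc (beta ^+ 3 - 2 * beta * gamma) + normc (kappa * gamma).
have K0 : 0 <= K by rewrite addr_ge0 ?normc_ge0.
have C0 : 0 <= C by rewrite addr_ge0 ?normc_ge0.
(* Each summand yields one bound: [r K <= 1 / 2] keeps [Re g >= 1 / 2], [r C <= 1] linearises a
   square, and [24 r C <= eta] makes the cubic error at most [eta / 8 * r^2], half of the gain
   [eta / 4 * r^2] that comes from [|g|^2 >= 1 / 4]. *)
pose m := 2 * K + C + 24 * C / eta + 1.
have Ce : 0 <= 24 * C / eta by rewrite divr_ge0 ?mulr_ge0 // ltW.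
have m0 : 0 < m by rewrite /m; lra.
exists m^-1; first by rewrite invr_gt0.
move=> s sm /=; set r := normc s in sm *; set g := 1 - beta * s + _.
have r0 : 0 <= r by exact: normc_ge0.
have rm : r * m <= 1 by rewrite -ler_pdivlMr // mul1r.
have r1 : r <= 1 by move: rm; rewrite /m; nra.
have rK : r * K <= 1 / 2 by move: rm; rewrite /m; nra.
have rC : r * C <= 1 by move: rm; rewrite /m; nra.
have rE : 24 * (r * C) <= eta.
  have : r * (24 * C / eta) <= 1 by move: rm; rewrite /m; nra.
  by rewrite !mulrA ler_pdivrMr // mul1r; lra.
pose v := beta * s - kappa * s ^+ 2.
have gv : g = 1 - v by rewrite /g /v /kappa; ring.
have vK : normc v <= 1 / 2.
  apply: le_trans rK; rewrite /v; apply: (le_trans (normcD _ _)).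
  rewrite normcN (normcM beta) (normcM kappa) normcX -/r /K.
  have k0 := normc_ge0 kappa.
  have : r ^+ 2 <= r by rewrite expr2 ler_piMr.
  by move/(ler_wpM2l k0); lra.
have Reg : 1 / 2 <= complex.Re g.
  rewrite gv raddfB /=; have := le_trans (ler_norm _) (le_trans (Re_normc v) vK); lra.
split => //.
pose f := 1 + (beta * s + gamma * s ^+ 2).
pose E := s ^+ 3 * (beta ^+ 3 - 2 * beta * gamma + kappa * gamma * s).
have gf : g * f = 1 + E by rewrite /g /f /E /kappa; ring.
have nE : normc E <= r ^+ 3 * C.
  rewrite /E normcM normcX -/r ler_wpM2l ?exprn_ge0 //.
  apply: (le_trans (normcD _ _)); rewrite lerD2l normcM -/r.
  by rewrite ler_piMr ?normc_ge0.
have nf : normc f ^+ 2 = 1 + 2 * complex.Re (beta * s + gamma * s ^+ 2)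
    + normc (beta * s + gamma * s ^+ 2) ^+ 2.
  rewrite /f; move: (_ + gamma * _) => [a b]; rewrite !normc_sqr /=; ring.
have ngf : normc g ^+ 2 * normc f ^+ 2 <= 1 + 3 * (r ^+ 3 * C).
  rewrite -exprMn -normcM gf.
  have h1 : normc (1 + E) <= 1 + r ^+ 3 * C.
    by apply: (le_trans (normcD _ _)); rewrite normc1 lerD2l.
  have h2 : 0 <= r ^+ 3 * C by rewrite mulr_ge0 ?exprn_ge0.
  have h3 : r ^+ 3 * C <= 1.
    apply: le_trans rC; rewrite ler_wpM2r // exprSr ler_piMl //.
    by rewrite expr_le1.
  apply: (@le_trans _ _ ((1 + r ^+ 3 * C) ^+ 2)).
    by rewrite ler_pXn2r ?nnegrE ?normc_ge0 ?addr_ge0.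
  nra.
have g14 : 1 / 4 <= normc g ^+ 2.
  have := le_trans (ler_norm _) (Re_normc g); have := normc_ge0 g; nra.
have r3 : r ^+ 3 * C <= r ^+ 2 * (eta / 24).
  by rewrite exprSr -mulrA ler_wpM2l ?sqr_ge0 //; lra.
have u0 : 0 <= normc (beta * s + gamma * s ^+ 2) ^+ 2 by rewrite sqr_ge0.
have q0 : 1 + 2 * complex.Re (beta * s + gamma * s ^+ 2) - eta * r ^+ 2 <=
  normc f ^+ 2 - eta * r ^+ 2 by rewrite nf; lra.
have G0 : 0 <= normc g ^+ 2 by rewrite sqr_ge0.
apply: (le_trans (ler_wpM2l G0 q0)); rewrite mulrBr.
have e2 : 0 <= eta * r ^+ 2 by rewrite mulr_ge0 ?sqr_ge0 ?ltW.
have := ler_wpM2r e2 g14; lra.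
Qed.

End DistanceDisc.

Section StrictDisc.
Context {R : realType} {n : nat}.
Implicit Types (z w A B N y : 'C[R]_n) (W : set 'C[R]_n).

(** The room [e |s|^2] around the disc allows a test displacement by [|s|^2 N] across the boundary,
    which turns a weak second-order inequality into a strict one. *)
Definition strict_disc W z : Prop :=
  exists A B (r e : R), [/\ 0 < r, 0 < e &
    forall a b y, a ^+ 2 + b ^+ 2 <= r ^+ 2 -> 0 < a ^+ 2 + b ^+ 2 ->
      enorm y <= e * (a ^+ 2 + b ^+ 2) -> W (qdisc z A B a b + y)].

(** With [g] quadratic in [s], the displaced disc [z + s w + g(s) V] is again a quadratic disc,
    centred at [z + V]; pushing its centre by a multiple of [- V] lowers only the real part of
    [g]. *)
Lemma qdisc_shift (beta kappa : R[i]) z w (V : 'C[R]_n) (a b s : R) :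
  let g := 1 - beta * (a +i* b)%C + kappa * (a +i* b)%C ^+ 2 in
  qdisc (z + V + s *: - V) (w - cmul (complex.Re beta) (complex.Im beta) V)
    (cmul (complex.Re kappa) (complex.Im kappa) V) a b =
  (z + cmul a b w) + cmul (complex.Re g - s) (complex.Im g) V.
Proof.
by case: beta kappa => [p q] [k1 k2]; rewrite /qdisc expr2 /=; vring.
Qed.

Lemma touching_strict_disc W z w (b1 b2 c1 c2 e r : R) :
    open W -> W <> setT -> W z -> 0 < e -> 0 < r ->
    (forall a b, a ^+ 2 + b ^+ 2 <= r ^+ 2 -> W (z + cmul a b w) /\
      (dist W (z + cmul a b w)) ^- 2 <= (dist W z) ^- 2 + (b1 * a + b2 * b)
        + (c1 * (a ^+ 2 - b ^+ 2) + c2 * (2 * a * b)) - e * (a ^+ 2 + b ^+ 2)) ->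
  exists zeta, [/\ boundary W zeta, ~ W zeta, pushed_disc W zeta & strict_disc W zeta].
Proof.
move=> oW WT Wz e0 r0 h; pose d := dist W z.
have d0 : 0 < d by exact: dist_gt0.
have [zeta Wzeta dz] := dist_nearest z oW WT.
have bz := nearest_boundary oW WT Wz Wzeta dz.
pose V := zeta - z.
have V0 : enorm V = d by rewrite /V enormB -dz.
(* The touching inequality is multiplied by [d^2], and [b1 a + b2 b] is the real part of
   [(b1 - i b2) (a + i b)]; the halves and the minus signs match the form
   [1 + 2 Re (beta s + gamma s^2)]. *)
pose h2 := d ^+ 2 / 2.
pose beta := ((h2 * b1) +i* (- (h2 * b2)))%C.
pose gamma := ((h2 * c1) +i* (- (h2 * c2)))%C.
pose eta := d ^+ 2 * e.
have d20 : 0 < d ^+ 2 by rewrite exprn_gt0.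
have eta0 : 0 < eta by rewrite mulr_gt0.
have [r1 r10 hr1] := quadratic_reciprocal beta gamma eta0.
pose kappa := beta ^+ 2 - gamma.
pose A := w - cmul (complex.Re beta) (complex.Im beta) V.
pose B := cmul (complex.Re kappa) (complex.Im kappa) V.
pose g := fun a b : R => 1 - beta * (a +i* b)%C + kappa * (a +i* b)%C ^+ 2.
have gE a b (s : R) : qdisc (zeta + s *: - V) A B a b =
    (z + cmul a b w) + cmul (complex.Re (g a b) - s) (complex.Im (g a b)) V.
  by rewrite [in LHS](_ : zeta = z + V) ?qdisc_shift // /V addrC subrK.
pose rho := Num.min 1 (Num.min r (Num.min r1 (1 / (eta + 1)))).
have e1 : 0 < eta + 1 by lra.
have rho0 : 0 < rho by rewrite !lt_min ltr01 r0 r10 divr_gt0.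
have /and4P[rho1 rhor rhor1 rhoe] :
    [&& rho <= 1, rho <= r, rho <= r1 & rho <= 1 / (eta + 1)].
  by rewrite /rho !ge_min !lexx !orbT.
(* Taking square roots leaves [eta / 16], the bound [dist >= d / 2] costs a factor 2, and a further
   factor 2 makes the clearance strict. *)
pose eps := eta * d / 64.
have eps0 : 0 < eps by rewrite divr_gt0 // mulr_gt0.
have main (a b : R) : a ^+ 2 + b ^+ 2 <= rho ^+ 2 ->
   [/\ 1 / 2 <= complex.Re (g a b),
       normc (g a b) * d <= dist W (z + cmul a b w)
     & 0 < a ^+ 2 + b ^+ 2 ->
       normc (g a b) * d + eps * (a ^+ 2 + b ^+ 2) < dist W (z + cmul a b w)].
  move=> ab; set s := a ^+ 2 + b ^+ 2 in ab *.
  have s0 : 0 <= s by rewrite addr_ge0 ?sqr_ge0.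
  have nab : normc (a +i* b)%C = Num.sqrt s by [].
  have nab2 : normc (a +i* b)%C ^+ 2 = s by rewrite nab sqr_sqrtr.
  have srho : Num.sqrt s <= rho.
    by rewrite -[leRHS](gtr0_norm rho0) -sqrtr_sqr ler_wsqrtr.
  have nr1 : normc (a +i* b)%C <= r1 by rewrite nab (le_trans srho).
  have [] := hr1 _ nr1; rewrite -/kappa -/(g a b) nab2 => Reg hg.
  have [|Wab hd] := h a b.
    by apply: (le_trans ab); rewrite ler_pXn2r ?nnegrE ?(ltW rho0) ?(ltW r0).
  set D := dist W (z + cmul a b w) in hd *.
  have D0 : 0 < D by exact: dist_gt0.
  have D20 : 0 < D ^+ 2 by rewrite exprn_gt0.
  have Gd : (normc (g a b) * d) ^+ 2 <= (1 - eta / 8 * s) * D ^+ 2.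
    have q1 : d ^+ 2 <= (1 + 2 * complex.Re (beta * (a +i* b)%C
        + gamma * (a +i* b)%C ^+ 2) - eta * s) * D ^+ 2.
      rewrite -ler_pdivrMr //.
      have := ler_wpM2l (ltW d20) hd; rewrite -/d => /le_trans; apply.
      rewrite le_eqVlt; apply/orP; left; apply/eqP.
      by rewrite expr2 /= /beta /gamma /h2 /eta /s; field; rewrite gt_eqF.
    have := ler_wpM2l (sqr_ge0 (normc (g a b))) q1.
    have := ler_wpM2r (ltW D20) hg; rewrite exprMn; lra.
  have es1 : eta * s <= 1.
    have : rho * (eta + 1) <= 1 by rewrite -ler_pdivlMr.
    have : s <= rho by apply: (le_trans ab); rewrite expr2 ler_piMr // ltW.
    nra.
  have gd0 : 0 <= normc (g a b) * d by rewrite mulr_ge0 ?normc_ge0 // ltW.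
  have es0 : 0 <= eta * s by rewrite mulr_ge0 // ltW.
  have G2 : normc (g a b) * d <= (1 - eta / 16 * s) * D.
    have f0 : 0 <= 1 - eta / 16 * s by lra.
    rewrite -(@ler_pXn2r _ 2) ?nnegrE // ?(mulr_ge0 f0) ?(ltW D0) //.
    apply: (le_trans Gd); rewrite exprMn ler_wpM2r ?(ltW D20) //; nra.
  have gh : 1 / 2 <= normc (g a b).
    by apply: le_trans (Re_normc _); apply: le_trans (ler_norm _).
  have dD : d / 2 <= D by move: (G2); nra.
  split => //; first by move: (G2); nra.
  move=> s1; have es2 : 0 < eta * s by rewrite mulr_gt0.
  rewrite /eps; move: (G2); nra.
exists zeta; split => //.
- exists A, B, (- V), rho, (1 / 2); split => //.
  move=> a b s ab /andP[s0 s1] nz; rewrite gE.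
  have [Reg gd gds] := main a b ab.
  apply: (dist_ball (z := z + cmul a b w)); rewrite addrAC subrr add0r.
  rewrite enorm_cmul V0.
  have [s00|sp] := eqVneq s 0.
    rewrite s00 subr0 -normc_sqr sqrtr_sqr ger0_norm ?normc_ge0 //.
    have ab0 : 0 < a ^+ 2 + b ^+ 2.
      rewrite lt_neqAle addr_ge0 ?sqr_ge0 // andbT eq_sym.
      rewrite paddr_eq0 ?sqr_ge0 // !sqrf_eq0; apply/negP => /andP[/eqP a0 /eqP b0].
      exact: nz.
    apply: le_lt_trans (gds ab0); rewrite lerDl mulr_ge0 ?ltW //.
  (* From [0 < s <= 1 / 2 <= Re g] follows [|g - s| < |g|], so the non-strict bound suffices, also
     at the centre of the disc. *)
  have s0' : 0 < s by rewrite lt_neqAle eq_sym sp.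
  apply: lt_le_trans gd; rewrite ltr_pM2r //.
  rewrite -[ltRHS]ger0_norm ?normc_ge0 // -sqrtr_sqr normc_sqr ltr_sqrt.
    by rewrite ltrD2r; nra.
  by have := sqr_ge0 (complex.Im (g a b)); nra.
- exists A, B, rho, eps; split => // a b y ab ab0 ye.
  have := gE a b 0; rewrite scale0r addr0 subr0 => ->.
  have [Reg gd gds] := main a b ab.
  apply: (dist_ball (z := z + cmul a b w)).
  rewrite -[_ + _ + y]addrA addrAC subrr add0r.
  apply: le_lt_trans (gds ab0); apply: (le_trans (enormD _ _)); apply: lerD => //.
  by rewrite enorm_cmul V0 -normc_sqr sqrtr_sqr ger0_norm ?normc_ge0.
Qed.

End StrictDisc.

(** * Second-order calculus with directional derivatives *)

Section DirectionalDerivatives.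
Context {R : realType} {n : nat}.
Implicit Types (x z u v w : 'C[R]_n) (f rho : 'C[R]_n -> R) (V : set 'C[R]_n).

Lemma is_derive_line f x v (t : R) : derivable f (t *: v + x) v ->
  is_derive t (1 : R) (fun s : R => f (s *: v + x)) ('D_v f (t *: v + x)).
Proof.
move=> df.
have E : (fun h : R => h^-1 *: (((fun s : R => f (s *: v + x)) \o shift t) (h *: (1 : R))
      - f (t *: v + x))) =
    (fun h : R => h^-1 *: ((f \o shift (t *: v + x)) (h *: v) - f (t *: v + x))).
  apply/funext => h /=; congr (_ *: (f _ - _)).
  by rewrite scalerDl addrA [_%:A]mulr1.
by apply: DeriveDef; rewrite /derivable /derive E.
Qed.

Lemma deriveZ_dir f z v (c : R) : (forall w, derivable f z w) ->
  'D_(c *: v) f z = c * 'D_v f z.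
Proof.
move=> df.
have d1 : is_derive (c * 0) (1 : R) (fun s : R => f (s *: v + z)) ('D_v f z).
  have := @is_derive_line f z v (c * 0).
  by rewrite mulr0 scale0r add0r; apply; exact: df.
have d2 : is_derive (0 : R) (1 : R) (fun s : R => c * s) c.
  by apply: is_derive_eq; rewrite /GRing.scale /= mulr1.
have d3 := @is_derive_line f z (c *: v) 0.
have := is_derive1_comp d1 d2.
have -> : (fun s : R => f (s *: v + z)) \o (fun s : R => c * s) =
          (fun s : R => f (s *: (c *: v) + z)).
  by apply/funext => s /=; rewrite scalerA mulrC.
move=> [_ E1]; rewrite scale0r add0r in d3.
by have [_ E2] := d3 (df _); rewrite -E2 E1 mulrC.
Qed.

Lemma mean_value_dir f x v : (forall t : R, 0 <= t <= 1 -> derivable f (x + t *: v) v) ->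
  exists2 t : R, 0 <= t <= 1 & f (x + v) - f x = 'D_v f (x + t *: v).
Proof.
move=> df; pose g := fun s : R => f (s *: v + x).
have dg (t : R) : 0 <= t <= 1 -> is_derive t (1 : R) g ('D_v f (t *: v + x)).
  by move=> /df ?; apply: is_derive_line; rewrite addrC.
have [||t] := @MVT_segment R g (fun t => 'D_v f (t *: v + x)) 0 1 ler01.
- move=> t; rewrite in_itv /= => /andP[t0 t1]; apply: dg.
  by rewrite !ltW.
- apply: derivable_within_continuous => t; rewrite in_itv /= => t01.
  by have [] := dg t t01.
rewrite in_itv /= subr0 mulr1 => t01 E; exists t => //.
rewrite (addrC x (t *: v)) -E /g.
by rewrite scale1r scale0r add0r (addrC x v).
Qed.

Definition C1_on V f : Prop :=
  forall v z, V z -> derivable f z v /\ {for z, continuous ('D_v f)}.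

(** The quotient for [v + w] minus the one for [v] is an increment along [h w] starting at
    [z + h v]. By the mean value theorem it is a [w]-derivative at a point near [z], and continuity
    of that derivative gives the limit. *)
Lemma deriveD_dir V f z v w : open V -> C1_on V f -> V z ->
  'D_(v + w) f z = 'D_v f z + 'D_w f z.
Proof.
move=> oV fV Vz.
pose q := fun (u : 'C[R]_n) (h : R) => h^-1 *: ((f \o shift z) (h *: u) - f z).
have cq u : q u h @[h --> 0^'] --> 'D_u f z by have [] := fV u z Vz.
rewrite [RHS]addrC; apply/eqP; rewrite -subr_eq; apply/eqP.
have l1 : q (v + w) h - q v h @[h --> 0^'] --> 'D_(v + w) f z - 'D_v f z.
  exact: (cvgB (cq _) (cq _)).
apply: (cvg_unique (@Rhausdorff R) l1).
apply/cvgrPdist_lt => e e0.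
have : \forall y \near z, V y /\ `|'D_w f z - 'D_w f y| < e.
  apply: filterI; first exact: open_nbhs_nbhs.
  have [_ cw] := fV w z Vz.
  by move/cvgrPdist_lt: cw; apply.
move/nbhs_eballP => [d d0 hd].
pose m := enorm v + enorm w + 1.
have m0 : 0 < m by rewrite /m; have := enorm_ge0 v; have := enorm_ge0 w; lra.
have dm0 : 0 < d / m by rewrite divr_gt0.
apply/nbhs_ballP; exists (d / m) => //= h.
rewrite /ball /= sub0r normrN => hdm h0.
have hm : `|h| * m < d by rewrite -ltr_pdivlMr.
have near_z (t : R) : 0 <= t <= 1 -> eball z d ((z + h *: v) + t *: (h *: w)).
  move=> /andP[t0 t1]; rewrite /eball /=.
  rewrite (_ : _ - z = h *: v + (t * h) *: w); last by vring.
  apply: (le_lt_trans (enormD _ _)); rewrite !enormZ normrM (ger0_norm t0).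
  have := normr_ge0 h; have := enorm_ge0 w; have := enorm_ge0 v.
  move: hm; rewrite /m => hm v0 w0 hh0.
  have : t * `|h| * enorm w <= `|h| * enorm w.
    by rewrite -mulrA ler_piMl // mulr_ge0.
  lra.
have [t /near_z/hd[Vt ht] E] : exists2 t : R, 0 <= t <= 1 &
    f (z + h *: v + h *: w) - f (z + h *: v) =
    'D_(h *: w) f ((z + h *: v) + t *: (h *: w)).
  by apply: mean_value_dir => t /near_z/hd[Vt _]; have [] := fV (h *: w) _ Vt.
rewrite deriveZ_dir in E; last by move=> u; have [] := fV u _ Vt.
suff -> : q (v + w) h - q v h = 'D_w f (z + h *: v + t *: (h *: w)) by [].
have e1 : h *: (v + w) + z = z + h *: v + h *: w by vring.
rewrite /q -scalerBr /= e1 (addrC (h *: v)) opprB addrA subrK.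
by rewrite E /GRing.scale /= mulKf.
Qed.

Definition cbasis1 (j : 'I_n) : 'C[R]_n := (delta_mx 0 j, 0).
Definition cbasis2 (j : 'I_n) : 'C[R]_n := (0, delta_mx 0 j).

Lemma cbasis_decomp u :
  u = \sum_j (u.1 0 j *: cbasis1 j + u.2 0 j *: cbasis2 j).
Proof.
have s1 (F : 'I_n -> 'C[R]_n) : (\sum_j F j).1 = \sum_j (F j).1.
  by elim/big_rec2: _ => // j y1 y2 _ <-.
have s2 (F : 'I_n -> 'C[R]_n) : (\sum_j F j).2 = \sum_j (F j).2.
  by elim/big_rec2: _ => // j y1 y2 _ <-.
have sum_delta (a : 'rV[R]_n) j0 : a 0 j0 = \sum_j a 0 j * (j0 == j)%:R.
  rewrite (bigD1 j0) //= eqxx mulr1 big1 ?addr0 // => j; rewrite eq_sym => /negPf ->.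
  by rewrite mulr0.
apply: Cn_ext => j0; rewrite ?s1 ?s2 summxE {1}sum_delta; apply: eq_bigr => j _;
  by rewrite /= !mxE /= ?mulr0 ?addr0 ?add0r.
Qed.

Lemma derive_coord V f z u : open V -> C1_on V f -> V z ->
  'D_u f z = \sum_j (u.1 0 j * 'D_(cbasis1 j) f z + u.2 0 j * 'D_(cbasis2 j) f z).
Proof.
move=> oV fV Vz; have df w : derivable f z w by have [] := fV w z Vz.
rewrite {1}(cbasis_decomp u).
have -> (F : 'I_n -> 'C[R]_n) : 'D_(\sum_j F j) f z = \sum_j 'D_(F j) f z.
  apply: (big_ind2 (fun w a => 'D_w f z = a)) => //; first exact: derive0.
  by move=> w1 a1 w2 a2 <- <-; exact: (deriveD_dir _ _ oV fV Vz).
apply: eq_bigr => j _.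
by rewrite (deriveD_dir _ _ oV fV Vz) !deriveZ_dir.
Qed.

Lemma coord1_continuous (T : topologicalType) (x : T) (F : T -> 'C[R]_n) j :
  F @ x --> F x -> (fun y => (F y).1 0 j) @ x --> (F x).1 0 j.
Proof.
move=> cF; apply: (@continuous_comp _ _ _ F (fun u : 'C[R]_n => u.1 0 j)) => //.
apply: (@continuous_comp _ _ _ fst (fun a : 'rV[R]_n => a 0 j)); first exact: cvg_fst.
exact: coord_continuous.
Qed.

Lemma coord2_continuous (T : topologicalType) (x : T) (F : T -> 'C[R]_n) j :
  F @ x --> F x -> (fun y => (F y).2 0 j) @ x --> (F x).2 0 j.
Proof.
move=> cF; apply: (@continuous_comp _ _ _ F (fun u : 'C[R]_n => u.2 0 j)) => //.
apply: (@continuous_comp _ _ _ snd (fun a : 'rV[R]_n => a 0 j)); first exact: cvg_snd.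
exact: coord_continuous.
Qed.

(** The hypothesis gives continuity in the point for each fixed direction; in a basis the moving
    direction enters only through continuous coefficients. *)
Lemma derive_jointly_continuous (T : topologicalType) V f (x : T)
    (X U : T -> 'C[R]_n) : open V -> C1_on V f -> V (X x) ->
  X @ x --> X x -> U @ x --> U x ->
  (fun y => 'D_(U y) f (X y)) @ x --> 'D_(U x) f (X x).
Proof.
move=> oV fV Vx cX cU.
rewrite (derive_coord _ oV fV Vx).
have : \forall y \near x, \sum_j ((U y).1 0 j * 'D_(cbasis1 j) f (X y)
      + (U y).2 0 j * 'D_(cbasis2 j) f (X y)) = 'D_(U y) f (X y).
  have : \forall y \near x, V (X y) by apply: cX; exact: open_nbhs_nbhs.
  by apply: filterS => y Vy; rewrite (derive_coord _ oV fV Vy).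
move/near_eq_cvg => h; apply: cvg_trans h _.
apply: cvg_big => [|j _]; first exact: add_continuous.
have cD e : (fun y => 'D_e f (X y)) @ x --> 'D_e f (X x).
  apply: (@continuous_comp _ _ _ X ('D_e f)) => //.
  by have [] := fV e _ Vx.
exact: (cvgD (cvgM (coord1_continuous cU) (cD _)) (cvgM (coord2_continuous cU) (cD _))).
Qed.

Lemma C2_on_C1 V rho : C2_on V rho -> C1_on V rho.
Proof. by move=> [_ h _] v z; exact: h. Qed.

Lemma C2_on_deriveC1 V rho v : C2_on V rho -> C1_on V ('D_v rho).
Proof. by move=> [_ _ h] w z; exact: h. Qed.

Lemma derive2_coord V rho z u w : open V -> C2_on V rho -> V z ->
  'D_w ('D_u rho) z = \sum_j (u.1 0 j * 'D_w ('D_(cbasis1 j) rho) z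
     + u.2 0 j * 'D_w ('D_(cbasis2 j) rho) z).
Proof.
move=> oV fV Vz; have fV1 := C2_on_C1 fV.
have : \near z, 'D_u rho z = (\sum_j (u.1 0 j *: 'D_(cbasis1 j) rho
     + u.2 0 j *: 'D_(cbasis2 j) rho)) z.
  have : \forall y \near z, V y by exact: open_nbhs_nbhs.
  apply: filterS => y Vy; rewrite (derive_coord _ oV fV1 Vy) fct_sumE.
  by apply: eq_bigr.
move/near_eq_derive => ->.
have d e : derivable ('D_e rho) z w by have [] := C2_on_deriveC1 e fV w Vz.
rewrite derive_sum; last by move=> j; apply: derivableD; apply: derivableZ.
apply: eq_bigr => j _; rewrite deriveD ?deriveZ //; exact: derivableZ.
Qed.

Lemma derive2_jointly_continuous (T : topologicalType) V rho (x : T)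
    (X U W : T -> 'C[R]_n) : open V -> C2_on V rho -> V (X x) ->
  X @ x --> X x -> U @ x --> U x -> W @ x --> W x ->
  (fun y => 'D_(W y) ('D_(U y) rho) (X y)) @ x --> 'D_(W x) ('D_(U x) rho) (X x).
Proof.
move=> oV fV Vx cX cU cW.
set D := fun y => 'D_(W y) ('D_(U y) rho) (X y).
refine (eq_ind_r (fun l : R => D @ x --> l) _ (derive2_coord (U x) (W x) oV fV Vx)).
have : \forall y \near x, \sum_j ((U y).1 0 j * 'D_(W y) ('D_(cbasis1 j) rho) (X y)
      + (U y).2 0 j * 'D_(W y) ('D_(cbasis2 j) rho) (X y))
    = 'D_(W y) ('D_(U y) rho) (X y).
  have : \forall y \near x, V (X y) by apply: cX; exact: open_nbhs_nbhs.
  by apply: filterS => y Vy; rewrite (derive2_coord _ _ oV fV Vy).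
move/near_eq_cvg => h; apply: cvg_trans h _.
apply: cvg_big => [|j _]; first exact: add_continuous.
have cD e : (fun y => 'D_(W y) ('D_e rho) (X y)) @ x --> 'D_(W x) ('D_e rho) (X x).
  exact: (derive_jointly_continuous oV (C2_on_deriveC1 e fV)).
exact: (cvgD (cvgM (coord1_continuous cU) (cD _)) (cvgM (coord2_continuous cU) (cD _))).
Qed.

Lemma taylor2_dir V rho x h : C2_on V rho ->
    (forall t : R, 0 <= t <= 1 -> V (x + t *: h)) ->
  exists2 t : R, 0 <= t <= 1 &
    rho (x + h) = rho x + 'D_h rho x + 'D_h ('D_h rho) (x + t *: h) / 2.
Proof.
move=> fV hV.
pose g := fun s : R => rho (s *: h + x).
pose g1 := fun s : R => 'D_h rho (s *: h + x).
pose g2 := fun s : R => 'D_h ('D_h rho) (s *: h + x).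
have dg (s : R) : 0 <= s <= 1 -> is_derive s (1 : R) g (g1 s).
  move=> /hV; rewrite addrC => Vs; apply: is_derive_line.
  by have [] := C2_on_C1 fV h Vs.
have dg1 (s : R) : 0 <= s <= 1 -> is_derive s (1 : R) g1 (g2 s).
  move=> /hV; rewrite addrC => Vs; apply: is_derive_line.
  by have [] := C2_on_deriveC1 h fV h Vs.
(* [c] is chosen so that [k 0 = k 1], and Rolle's theorem applies to [k]. *)
pose c := g 1 - g 0 - g1 0.
pose k := fun s : R => g s + (1 - s) * g1 s + (1 - s) ^+ 2 * c.
have dk (s : R) : 0 <= s <= 1 ->
    is_derive s (1 : R) k ((1 - s) * (g2 s - 2 * c)).
  move=> s01; have D0 := dg s s01; have D1 := dg1 s s01.
  have D2 : is_derive s (1 : R) (fun s : R => 1 - s) (- 1).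
    by apply: is_derive_eq; rewrite add0r mul1r.
  apply: is_derive_eq.
  by rewrite /GRing.scale /=; ring.
have [|||t] := @Rolle R k 0 1 ltr01.
- move=> s; rewrite in_itv /= => /andP[s0 s1].
  by have [] := dk s; rewrite ?ltW.
- apply: derivable_within_continuous => t; rewrite in_itv /= => t01.
  by have [] := dk t t01.
- by rewrite /k /c; ring.
rewrite in_itv /= => /andP[t0 t1] dt; exists t; first by rewrite !ltW.
have := dk t; rewrite !ltW // => /(_ isT) [_ E1]; have [_ E2] := dt.
have : (1 - t) * (g2 t - 2 * c) = 0 by rewrite -E1 -E2.
move/eqP; rewrite mulf_eq0 subr_eq0 gt_eqF //= subr_eq0 => /eqP E.
rewrite [x + t *: h]addrC -/(g2 t) E.
have -> : rho (x + h) = g 1 by rewrite /g scale1r addrC.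
have -> : rho x = g 0 by rewrite /g scale0r add0r.
have -> : 'D_h rho x = g1 0 by rewrite /g1 scale0r add0r.
by rewrite /c; field.
Qed.

End DirectionalDerivatives.

(** * Stability of the Levi condition *)

Section Perturbation.
Context {R : realType} {n : nat}.
Implicit Types (x z u v w A B N : 'C[R]_n) (rho : 'C[R]_n -> R) (W V : set 'C[R]_n).

Lemma derive2Z V rho z u (c : R) : open V -> C2_on V rho -> V z ->
  'D_(c *: u) ('D_(c *: u) rho) z = c ^+ 2 * 'D_u ('D_u rho) z.
Proof.
move=> oV fV Vz.
have E w : 'D_w ('D_(c *: u) rho) z = c * 'D_w ('D_u rho) z.
  apply: etrans (derive2_coord (c *: u) w oV fV Vz) _.
  apply: etrans _ (esym (congr1 ( *%R c) (derive2_coord u w oV fV Vz))).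
  rewrite mulr_sumr; apply: eq_bigr => j _.
  have alg (a b d1 d2 : R) : c * a * d1 + c * b * d2 = c * (a * d1 + b * d2).
    by ring.
  have -> : (c *: u).1 0 j = c * u.1 0 j by rewrite mxE.
  have -> : (c *: u).2 0 j = c * u.2 0 j by rewrite mxE.
  exact: alg.
have df w : derivable ('D_u rho) z w by have [] := C2_on_deriveC1 u fV w Vz.
apply: etrans (E _) _; apply: etrans (congr1 ( *%R c) (deriveZ_dir u c df)) _.
by rewrite mulrA.
Qed.

(** Made for the mean value and Taylor theorems, whose intermediate point on the segment is not
    known. *)
Lemma near_segment (u : R -> 'C[R]_n) z (P : R -> 'C[R]_n -> Prop) :
  {for 0, continuous u} -> (\forall p \near ((0 : R), z), P p.1 p.2) ->
  exists2 d : R, 0 < d & forall t s : R, 0 < t < d -> 0 <= s <= 1 ->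
    P t (z + s *: (t *: u t)).
Proof.
move=> cu [[T1 T2] /= [nT1 /nbhs_eballP[d2 d20 hT2]] hP].
have ctu : (fun t : R => enorm (t *: u t)) @ (0 : R) --> (0 : R).
  rewrite -[X in _ --> X](@enorm0 R n) -[X in enorm X](scale0r (u 0)).
  apply: (@continuous_comp _ _ _ (fun t : R => t *: u t) (@enorm R n));
    last exact: enorm_continuous.
  by apply: cvgZ; [exact: cvg_id|exact: cu].
have n1 : \forall t \near (0 : R), T1 t /\ enorm (t *: u t) < d2.
  by apply: filterI => //; move/cvgr_lt: ctu; apply.
have /nbhs_ballP[d d0 hd] := n1.
exists d => // t s /andP[t0 td] /andP[s0 s1].
have [Tt ut] : T1 t /\ enorm (t *: u t) < d2.
  by apply: hd; rewrite /ball /= sub0r normrN gtr0_norm.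
apply: (hP (t, z + s *: (t *: u t))); split => //=; apply: hT2.
rewrite /eball /= addrAC subrr add0r enormZ ger0_norm //.
by apply: le_lt_trans ut; rewrite ler_piMl ?enorm_ge0.
Qed.

Lemma cmul_continuous2 (T : topologicalType) (x : T) (a b : T -> R)
    (F : T -> 'C[R]_n) : a @ x --> a x -> b @ x --> b x -> F @ x --> F x ->
  (fun y => cmul (a y) (b y) (F y)) @ x --> cmul (a x) (b x) (F x).
Proof.
move=> ca cb cF.
have c1 : (fun y => (F y).1) @ x --> (F x).1.
  by apply: (@continuous_comp _ _ _ F fst); [exact: cF|exact: cvg_fst].
have c2 : (fun y => (F y).2) @ x --> (F x).2.
  by apply: (@continuous_comp _ _ _ F snd); [exact: cF|exact: cvg_snd].
exact: (cvg_pair (cvgB (cvgZ ca c1) (cvgZ cb c2)) (cvgD (cvgZ ca c2) (cvgZ cb c1))).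
Qed.

Lemma push_decreasing V rho N z0 (d : R) : open V -> C1_on V rho ->
    (forall z, eball z0 d z -> V z /\ 0 < 'D_N rho z) ->
  forall x (s : R), eball z0 (d / 2) x -> 0 < s <= d / 2 / (enorm N + 1) ->
    V (x + s *: - N) /\ rho (x + s *: - N) < rho x.
Proof.
move=> oV c1 hd x s xd /andP[sp ss].
have m0 : 0 < enorm N + 1 by rewrite ltr_wpDl ?enorm_ge0.
have le01 : 0 <= (1 : R) <= 1 by rewrite ler01 lexx.
have sN : s * enorm N < d / 2.
  by move: ss; rewrite ler_pdivlMr // mulrDr mulr1; lra.
have ball th : 0 <= th <= 1 -> eball z0 d (x + th *: (s *: - N)).
  move=> /andP[th0 th1]; rewrite /eball /= addrAC.
  apply: (le_lt_trans (enormD _ _)); rewrite !enormZ enormN !ger0_norm ?(ltW sp) //.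
  rewrite /eball /= in xd.
  have : th * (s * enorm N) <= s * enorm N.
    by rewrite ler_piMl ?mulr_ge0 ?enorm_ge0 ?(ltW sp).
  lra.
split; first by have [] := hd _ (ball 1 le01); rewrite scale1r.
have [th th1 E] : exists2 th : R, 0 <= th <= 1 &
   rho (x + s *: - N) - rho x = 'D_(s *: - N) rho (x + th *: (s *: - N)).
  apply: mean_value_dir => th th1.
  by have [Vth _] := hd _ (ball _ th1); have [] := c1 (s *: - N) _ Vth.
have [Vth nth] := hd _ (ball _ th1).
have df w : derivable rho (x + th *: (s *: - N)) w.
  by have [dw _] := c1 w _ Vth; exact: dw.
have E2 : s *: - N = (- s) *: N by rewrite scalerN scaleNr.
rewrite -subr_lt0 E; move: (x + th *: (s *: - N)) df nth => y df nth.
rewrite E2 (deriveZ_dir N (- s) df) mulNr oppr_lt0.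
exact: mulr_gt0.
Qed.

(* The Levi-type condition at [z0] is stable: correcting [A] by a multiple of
   [N] keeps the disc tangent to the boundary at nearby boundary points, and the
   second-order term stays negative by continuity. *)
Lemma strict_disc_perturb W V rho z0 : open V -> V z0 ->
    local_defining_function W V rho -> boundary W z0 -> strict_disc W z0 ->
  exists2 d : R, 0 < d & forall z, eball z0 d z -> boundary W z -> pushed_disc W z.
Proof.
move=> oV Vz0 [c2 hgrad hW hb] bz0 [A [B [r [e [r0 e0 hs]]]]].
have c1 := C2_on_C1 c2.
have dv v z : V z -> derivable rho z v by move=> Vz; have [] := c1 v z Vz.
have le01 : 0 <= (1 : R) <= 1 by rewrite ler01 lexx.
have rz0 : rho z0 = 0 by apply/(hb _ Vz0).
have DD z v w : V z -> 'D_(v + w) rho z = 'D_v rho z + 'D_w rho z.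
  exact: (deriveD_dir _ _ oV c1).
have DZ z v (c : R) : V z -> 'D_(c *: v) rho z = c * 'D_v rho z.
  by move=> Vz; apply: deriveZ_dir => w; exact: dv.
have [v Dv] : exists v, 'D_v rho z0 != 0.
  apply: contrapT => /forallNP h; have /eqP := hgrad _ Vz0; apply.
  apply: Cn_ext => j; rewrite /grad /= !mxE; apply/eqP; apply: contrapT => /negP; exact: h.
(* An outward direction, normalised so that [|s|^2 N] is a displacement which [strict_disc]
   allows. *)
have [N [DN Ne]] : exists N, 0 < 'D_N rho z0 /\ enorm N <= e.
  have m0 : 0 < enorm v + 1 by rewrite ltr_wpDl ?enorm_ge0.
  exists ((Num.sg ('D_v rho z0) * (e / (enorm v + 1))) *: v); split.
    by rewrite (DZ _ _ _ Vz0) mulrAC -normrEsg mulr_gt0 ?normr_gt0 ?divr_gt0.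
  rewrite enormZ normrM normr_sg Dv mul1r gtr0_norm ?divr_gt0 //.
  by rewrite mulrAC ler_pdivrMr // ler_wpM2l ?(ltW e0) // lerDl.
pose Q (s : R * R) w := cmul s.1 s.2 w.
pose Q2 (s : R * R) w := cmul (s.1 ^+ 2 - s.2 ^+ 2) (2 * s.1 * s.2) w.
pose circ (s : R * R) := s.1 ^+ 2 + s.2 ^+ 2 = 1.
(* For [s] on the unit circle, [z0 + t u0] is the disc point of parameter [t s] displaced outwards
   by [t^2 N]; it still lies in [W]. *)
pose u0 s (t : R) := Q s A + t *: (Q2 s B + N).
have cu0 s : continuous (u0 s).
  by move=> t; apply: cvgD; [exact: cvg_cst|apply: cvgZr_tmp; exact: cvg_id].
have u00 s : u0 s 0 = Q s A by rewrite /u0 scale0r addr0.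
have neg s (t : R) : circ s -> 0 < t -> t <= r -> V (z0 + t *: u0 s t) ->
    rho (z0 + t *: u0 s t) < 0.
  move=> cs t0 tr Vt; apply/(hW _ Vt).
  have -> : z0 + t *: u0 s t = qdisc z0 A B (t * s.1) (t * s.2) + (t ^+ 2) *: N.
    by rewrite /u0 /Q /Q2 /qdisc; vring.
  have ts : (t * s.1) ^+ 2 + (t * s.2) ^+ 2 = t ^+ 2.
    by rewrite !exprMn -mulrDr cs mulr1.
  apply: hs; rewrite ts ?exprn_gt0 //; first by rewrite ler_pXn2r ?nnegrE ?(ltW r0) ?(ltW t0).
  by rewrite enormZ ger0_norm ?sqr_ge0 // mulrC ler_wpM2r ?sqr_ge0.
have alg (t x y : R) : t * (t * x) + t ^+ 2 * y / 2 = t ^+ 2 * (x + y / 2).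
  by field.
have alg2 (x y t : R) : x + y + t <= 0 -> 0 < y -> x + t < 0 by lra.
have fstc (p : R * 'C[R]_n) : fst @ p --> p.1 by exact: cvg_fst.
have sndc (p : R * 'C[R]_n) : snd @ p --> p.2 by exact: cvg_snd.
have u0c s : (fun p : R * 'C[R]_n => u0 s p.1) @ ((0 : R), z0) --> u0 s 0.
  exact: (@cvg_comp _ _ _ fst (u0 s) _ (nbhs (0:R)) _ cvg_fst (cu0 s 0)).
have nV : \forall p \near ((0 : R), z0), V p.2.
  by apply: sndc; exact: open_nbhs_nbhs.
have D1le s : circ s -> 'D_(Q s A) rho z0 <= 0.
  move=> cs; rewrite leNgt; apply/negP => Dpos.
  have n1 : \forall p \near ((0 : R), z0), V p.2 /\ 0 < 'D_(u0 s p.1) rho p.2.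
    apply: filterI => //.
    have := derive_jointly_continuous (x := ((0 : R), z0)) (X := snd)
      (U := fun p => u0 s p.1) oV c1 Vz0 (sndc _) (u0c s).
    by move/cvgr_gt => h; apply: h; rewrite /= u00.
  have [d d0 hd] := near_segment (P := fun t x => V x /\ 0 < 'D_(u0 s t) rho x)
    (cu0 s 0) n1.
  pose t := Num.min r (d / 2).
  have t0 : 0 < t by rewrite lt_min r0 divr_gt0.
  have tr : t <= r by rewrite ge_min lexx.
  have td : 0 < t < d.
    by rewrite t0 gt_min; apply/orP; right; rewrite ltr_pdivrMr // ltr_pMr // ltr1n.
  have [th th1] : exists2 th : R, 0 <= th <= 1 &
     rho (z0 + t *: u0 s t) - rho z0 = 'D_(t *: u0 s t) rho (z0 + th *: (t *: u0 s t)).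
    by apply: mean_value_dir => th th1; apply: dv; have [] := hd t th td th1.
  have [Vth Dth] := hd t th td th1.
  rewrite (DZ _ _ _ Vth) rz0 subr0 => E.
  have [V1 _] := hd t 1 td le01; rewrite scale1r in V1.
  have := neg s t cs t0 tr V1; rewrite E ltNge mulr_ge0 // ltW //.
have D10 s : circ s -> 'D_(Q s A) rho z0 = 0.
  move=> cs; apply: le_anti; apply/andP; split; first exact: D1le.
  have cs' : circ (- s.1, - s.2) by rewrite /circ /= !sqrrN.
  have := D1le _ cs'.
  have -> : Q (- s.1, - s.2) A = (- 1) *: Q s A by rewrite /Q; vring.
  by rewrite (DZ z0 _ _ Vz0) mulN1r oppr_le0.
(* The first-order term vanishes by [D10], and this is the coefficient of [t^2] along the displaced
   disc. Removing the positive contribution of [N] then makes the inequality strict. *)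
have D2le s : circ s ->
    'D_(Q2 s B + N) rho z0 + 'D_(Q s A) ('D_(Q s A) rho) z0 / 2 <= 0.
  move=> cs; rewrite leNgt; apply/negP => Dpos.
  have n1 : \forall p \near ((0 : R), z0), V p.2 /\
      0 < 'D_(Q2 s B + N) rho z0 + 'D_(u0 s p.1) ('D_(u0 s p.1) rho) p.2 / 2.
    apply: filterI => //.
    have h1 := derive2_jointly_continuous (x := ((0 : R), z0)) (X := snd)
      (U := fun p => u0 s p.1) (W := fun p => u0 s p.1) oV c2 Vz0 (sndc _) (u0c s) (u0c s).
    have h2 : (fun p : R * 'C[R]_n => 'D_(Q2 s B + N) rho z0 +
        'D_(u0 s p.1) ('D_(u0 s p.1) rho) p.2 / 2) @ ((0 : R), z0) -->
        'D_(Q2 s B + N) rho z0 + 'D_(u0 s 0) ('D_(u0 s 0) rho) z0 / 2.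
      exact: (cvgD (cvg_cst _) (cvgM h1 (cvg_cst (2^-1 : R)))).
    by move/cvgr_gt: h2 => h3; apply: h3; rewrite u00.
  have [d d0 hd] := near_segment (P := fun t x => V x /\
      0 < 'D_(Q2 s B + N) rho z0 + 'D_(u0 s t) ('D_(u0 s t) rho) x / 2)
    (cu0 s 0) n1.
  pose t := Num.min r (d / 2).
  have t0 : 0 < t by rewrite lt_min r0 divr_gt0.
  have tr : t <= r by rewrite ge_min lexx.
  have td : 0 < t < d.
    by rewrite t0 gt_min; apply/orP; right; rewrite ltr_pdivrMr // ltr_pMr // ltr1n.
  have [|th th1] := taylor2_dir (x := z0) (h := t *: u0 s t) c2.
    by move=> th th1; have [] := hd t th td th1.
  have [Vth Dth] := hd t th td th1.
  rewrite (derive2Z _ _ oV c2 Vth) (DZ _ _ _ Vz0) rz0 add0r {2}/u0.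
  rewrite (DD _ _ _ Vz0) (D10 _ cs) add0r (DZ _ _ _ Vz0) => E.
  have [V1 _] := hd t 1 td le01; rewrite scale1r in V1.
  have t20 : 0 < t ^+ 2 by rewrite exprn_gt0.
  by have := neg s t cs t0 tr V1; rewrite E alg ltNge (ltW (mulr_gt0 t20 Dth)).
have D2lt s : circ s -> 'D_(Q2 s B) rho z0 + 'D_(Q s A) ('D_(Q s A) rho) z0 / 2 < 0.
  by move=> cs; have := D2le s cs; rewrite (DD _ _ _ Vz0) => /alg2; apply.
pose J w := cmul 0 1 w.
pose n1 z := 'D_N rho z; pose n2 z := 'D_(J N) rho z.
pose a1 z := 'D_A rho z; pose a2 z := 'D_(J A) rho z.
(* The map sending [w] to ['D_w rho - i 'D_(J w) rho] is complex linear. The number [al1 + i al2] is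
   its value at [A] divided by its value at [N], so it vanishes at [A']; [det] is the squared
   modulus of the denominator. *)
pose det z := n1 z ^+ 2 + n2 z ^+ 2.
pose al1 z := (a1 z * n1 z + a2 z * n2 z) / det z.
pose al2 z := (a1 z * n2 z - a2 z * n1 z) / det z.
pose A' z := A - cmul (al1 z) (al2 z) N.
have a10 : a1 z0 = 0.
  have := D10 (1, 0); rewrite (_ : Q (1, 0) A = A); last by rewrite /Q; vring.
  by apply; rewrite /circ /= expr1n expr0n addr0.
have a20 : a2 z0 = 0.
  by apply: (D10 (0, 1)); rewrite /circ /= expr1n expr0n add0r.
have A'0 : A' z0 = A.
  have al10 : al1 z0 = 0 by rewrite /al1 a10 a20 !mul0r addr0 mul0r.
  have al20 : al2 z0 = 0 by rewrite /al2 a10 a20 !mul0r subr0 mul0r.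
  by rewrite /A' al10 al20; move: (A) (N) => A1 N1; vring.
have tang z s : V z -> det z != 0 -> 'D_(Q s (A' z)) rho z = 0.
  move=> Vz dz.
  have -> : Q s (A' z) = s.1 *: (A + ((- al1 z) *: N + (- al2 z) *: J N)) +
                        s.2 *: (J A + ((- al1 z) *: J N + (al2 z) *: N)).
    by rewrite /Q /A' /J; vring.
  rewrite !(DD _ _ _ Vz, DZ _ _ _ Vz) -/(a1 z) -/(a2 z) -/(n1 z) -/(n2 z) /al1 /al2.
  by rewrite /det in dz *; field.
have cD w : {for z0, continuous ('D_w rho)} by have [] := c1 w z0 Vz0.
have det0 : 0 < det z0 by rewrite /det ltr_wpDr ?sqr_ge0 // exprn_gt0.
have cdet : {for z0, continuous det}.
  exact: (cvgD (cvg_sqr (cD N)) (cvg_sqr (cD (J N)))).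
have cdV : (fun z => (det z)^-1) @ z0 --> (det z0)^-1.
  by apply: cvgV => //; rewrite gt_eqF.
have cA' : {for z0, continuous A'}.
  apply: cvgB; first exact: cvg_cst.
  apply: cmul_continuous2; last exact: cvg_cst.
    exact: (cvgM (cvgD (cvgM (cD A) (cD N)) (cvgM (cD (J A)) (cD (J N)))) cdV).
  exact: (cvgM (cvgB (cvgM (cD A) (cD (J N))) (cvgM (cD (J A)) (cD N))) cdV).
have /nbhs_eballP[d d0 hd] : \forall z \near z0, V z /\ 0 < n1 z.
  apply: filterI; first exact: open_nbhs_nbhs.
  by have := cD N; move/cvgr_gt; apply.
have d20 : 0 < d / 2 by rewrite divr_gt0.
pose T := ((R * R) * R * ('C[R]_n * R))%type.
pose U (q : T) := Q q.1.1 (A' q.2.1) + q.2.2 *: Q2 q.1.1 B.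
pose X (q : T) := q.2.1 + q.1.2 *: (q.2.2 *: U q).
pose P (p : 'C[R]_n * R) (k : (R * R) * R) := eball z0 (d / 2) (X (k, p)) /\
  'D_(Q2 k.1 B) rho p.1 + 'D_(U (k, p)) ('D_(U (k, p)) rho) (X (k, p)) / 2 < 0.
(* Compactness in the direction [s] and in the intermediate point [th] of Taylor's formula yields
   one neighbourhood of [(z0, 0)] for all of them. *)
pose K := [set s : R * R | s.1 ^+ 2 + s.2 ^+ 2 = 1 ^+ 2] `*` `[(0:R), 1].
have cK : compact K.
  by apply: compact_setX; [exact: compact_circle|exact: segment_compact].
have proj (q : T) : (fun q : T => q.1.1) @ q --> q.1.1.
  by apply: (@continuous_comp _ _ _ fst fst); exact: cvg_fst.
have proj1 (q : T) : (fun q : T => q.1.1.1) @ q --> q.1.1.1.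
  by apply: (@continuous_comp _ _ _ (fun q : T => q.1.1) fst); [exact: proj|exact: cvg_fst].
have proj2 (q : T) : (fun q : T => q.1.1.2) @ q --> q.1.1.2.
  by apply: (@continuous_comp _ _ _ (fun q : T => q.1.1) snd); [exact: proj|exact: cvg_snd].
have proj3 (q : T) : (fun q : T => q.1.2) @ q --> q.1.2.
  by apply: (@continuous_comp _ _ _ fst snd); [exact: cvg_fst|exact: cvg_snd].
have proj4 (q : T) : (fun q : T => q.2.1) @ q --> q.2.1.
  by apply: (@continuous_comp _ _ _ snd fst); [exact: cvg_snd|exact: cvg_fst].
have proj5 (q : T) : (fun q : T => q.2.2) @ q --> q.2.2.
  by apply: (@continuous_comp _ _ _ snd snd); exact: cvg_snd.
have near_K : \forall p \near (z0, (0 : R)), K `<=` P p.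
  have [ncK _] := compact_near_coveringP K.
  apply: (ncK cK _ (nbhs (z0, (0 : R))) P _) => -[s th] [/= cs th1].
  rewrite expr1n in cs.
  pose q0 : T := ((s, th), (z0, 0)).
  have cs1 : (fun q : T => q.1.1.1) @ q0 --> s.1 := proj1 q0.
  have cs2 : (fun q : T => q.1.1.2) @ q0 --> s.2 := proj2 q0.
  have cth : (fun q : T => q.1.2) @ q0 --> th := proj3 q0.
  have cz : (fun q : T => q.2.1) @ q0 --> z0 := proj4 q0.
  have ct : (fun q : T => q.2.2) @ q0 --> (0 : R) := proj5 q0.
  have cQ2 : (fun q : T => Q2 q.1.1 B) @ q0 --> Q2 s B.
    apply: (@cmul_continuous2 T q0 (fun q : T => q.1.1.1 ^+ 2 - q.1.1.2 ^+ 2)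
      (fun q : T => 2 * q.1.1.1 * q.1.1.2) (fun=> B)); last exact: cvg_cst.
      exact: (cvgB (@cvg_sqr _ T (fun q => q.1.1.1) q0 cs1)
        (@cvg_sqr _ T (fun q => q.1.1.2) q0 cs2)).
    exact: (cvgM (cvgM (cvg_cst _) cs1) cs2).
  have cA'q : (fun q : T => A' q.2.1) @ q0 --> A' z0.
    exact: (@cvg_comp _ _ _ (fun q : T => q.2.1) A' _ (nbhs z0) _ cz cA').
  have cU : U @ q0 --> U q0.
    apply: cvgD; last exact: (cvgZ ct cQ2).
    exact: (@cmul_continuous2 T q0 (fun q : T => q.1.1.1) (fun q : T => q.1.1.2)
      (fun q => A' q.2.1)).
  have cX : X @ q0 --> X q0.
    exact: (cvgD cz (cvgZ cth (cvgZ ct cU))).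
  have U0 : U q0 = Q s A by rewrite /U /= A'0 scale0r addr0.
  have X0 : X q0 = z0 by rewrite /X /= scale0r scaler0 addr0.
  have VX : V (X q0) by rewrite X0.
  have g1 := derive_jointly_continuous (x := q0) (X := fun q : T => q.2.1)
    (U := fun q => Q2 q.1.1 B) oV c1 Vz0 cz cQ2.
  have g2 := derive2_jointly_continuous (x := q0) oV c2 VX cX cU cU.
  have n3 : nbhs q0 ((fun q : T => eball z0 (d / 2) (X q)) `&`
       (fun q : T => 'D_(Q2 q.1.1 B) rho q.2.1 + 'D_(U q) ('D_(U q) rho) (X q) / 2 < 0)).
    apply: filterI; first by apply: cX; rewrite X0; exact: nbhs_eball.
    have g3 : (fun q : T => 'D_(Q2 q.1.1 B) rho q.2.1 +
        'D_(U q) ('D_(U q) rho) (X q) / 2) @ q0 -->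
        'D_(Q2 s B) rho z0 + 'D_(U q0) ('D_(U q0) rho) (X q0) / 2.
      exact: (cvgD g1 (cvgM g2 (cvg_cst (2^-1 : R)))).
    by move/cvgr_lt: g3 => g4; apply: g4; rewrite U0 X0; exact: D2lt.
  by apply: filterS n3 => -[k p].
move: near_K => [[T1 T2] /= [/nbhs_eballP[d1 d10 hT1] /nbhs_ballP[d2 d20' hT2]] hP].
have /nbhs_eballP[d3 d30 hd3] : \forall z \near z0, 0 < det z.
  by have := cdet; move/cvgr_gt; apply.
have m0 : 0 < enorm N + 1 by rewrite ltr_wpDl ?enorm_ge0.
pose s0 := d / 2 / (enorm N + 1).
have s00 : 0 < s0 by rewrite divr_gt0.
have push := push_decreasing oV c1 hd.
pose dd := Num.min d1 d3.
exists dd; first by rewrite lt_min d10.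
move=> z zdd bz.
have zd1 : eball z0 d1 z by rewrite /eball /=; apply: (lt_le_trans zdd); rewrite ge_min lexx.
have zd3 : eball z0 d3 z by rewrite /eball /=; apply: (lt_le_trans zdd); rewrite ge_min lexx orbT.
have key (t : R) (s : R * R) (th : R) : 0 <= t < d2 -> circ s -> 0 <= th <= 1 ->
    P (z, t) (s, th).
  move=> /andP[t0 td] cs th1; apply: (hP (z, t)).
    split => /=; first exact: hT1.
    by apply: hT2; rewrite /ball /= sub0r normrN ger0_norm.
  by split => //=; rewrite ?expr1n ?in_itv.
have circ10 : circ (1, 0) by rewrite /circ /= expr1n expr0n addr0.
have zd : eball z0 (d / 2) z.
  have [] := key 0 (1, 0) 0 _ circ10; rewrite ?lexx ?ler01 ?d20' //.
  by rewrite /X /= !scale0r addr0.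
have sub2 x : eball z0 (d / 2) x -> V x.
  move=> xd; have xd' : eball z0 d x.
    by rewrite /eball /=; apply: (lt_trans xd); rewrite ltr_pdivrMr // ltr_pMr // ltr1n.
  by have [] := hd x xd'.
have Vz := sub2 _ zd.
have rz : rho z = 0 by apply/(hb _ Vz).
exists (A' z), B, (- N), (d2 / 2), s0; split; [by rewrite divr_gt0|by []|].
move=> a b s ab /andP[sp ss] nz.
pose t := Num.sqrt (a ^+ 2 + b ^+ 2).
have ab0 : 0 <= a ^+ 2 + b ^+ 2 by rewrite addr_ge0 ?sqr_ge0.
have t0 : 0 <= t by exact: sqrtr_ge0.
have t2 : t ^+ 2 = a ^+ 2 + b ^+ 2 by rewrite sqr_sqrtr.
have [t00|tp] := eqVneq t 0.
  have [a0 b0] : a = 0 /\ b = 0.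
    move: t2; rewrite t00 expr0n => /esym/eqP; rewrite paddr_eq0 ?sqr_ge0 //.
    by rewrite !sqrf_eq0 => /andP[/eqP -> /eqP ->].
  have sp' : 0 < s.
    rewrite lt_neqAle sp andbT; apply/eqP => s1; exact: nz.
  have -> : qdisc (z + s *: - N) (A' z) B a b = z + s *: - N.
    by rewrite a0 b0 /qdisc; vring.
  have ss' : 0 < s <= s0 by rewrite sp' ss.
  have [V1 r1] := push z s zd ss'.
  by apply/(hW _ V1); rewrite rz in r1.
have tp0 : 0 < t by rewrite lt_neqAle eq_sym tp.
pose sg := (a / t, b / t).
have csg : circ sg.
  by rewrite /circ /= !expr_div_n -mulrDl -t2 divff // expf_neq0.
have td2 : 0 <= t < d2.
  rewrite t0 /=; apply: (@le_lt_trans _ _ (d2 / 2)); last first.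
    by rewrite ltr_pdivrMr // ltr_pMr // ltr1n.
  by rewrite -[leRHS]gtr0_norm ?divr_gt0 // -sqrtr_sqr ler_wsqrtr.
pose u := Q sg (A' z) + t *: Q2 sg B.
have PX th : 0 <= th <= 1 -> eball z0 (d / 2) (z + th *: (t *: u)) /\
   'D_(Q2 sg B) rho z + 'D_u ('D_u rho) (z + th *: (t *: u)) / 2 < 0.
  by move=> th1; exact: (key t sg th td2 csg th1).
have -> : qdisc (z + s *: - N) (A' z) B a b = (z + t *: u) + s *: - N.
  have at_ : a = t * sg.1 by rewrite /sg /= mulrC divfK.
  have bt_ : b = t * sg.2 by rewrite /sg /= mulrC divfK.
  rewrite at_ bt_ /u /Q /Q2 /qdisc; move: sg {at_ bt_ csg PX u} => [x y]; vring.
have [y1 _] := PX 1 le01; rewrite scale1r in y1.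
(* Tangency of [A' z] removes the first-order term, leaving [t^2] times the quantity that is
   negative by [P]. *)
have ry : rho (z + t *: u) < 0.
  have [|th th1] := taylor2_dir (x := z) (h := t *: u) c2.
    by move=> th /PX[/sub2].
  have [/sub2 Vth Dth] := PX th th1.
  rewrite (derive2Z _ _ oV c2 Vth) DZ // rz add0r {2}/u DD // tang //; last first.
    by rewrite gt_eqF //; exact: hd3.
  rewrite add0r DZ // => ->.
  have t20 : 0 < t ^+ 2 by rewrite exprn_gt0.
  by rewrite alg pmulr_rlt0.
have [s1|s1] := eqVneq s 0.
  rewrite s1 scale0r addr0; apply/hW => //; exact: sub2.
have ss' : 0 < s <= s0 by rewrite lt_neqAle eq_sym s1 sp ss.
have [V1 r1] := push _ s y1 ss'.
by apply/(hW _ V1); exact: lt_trans r1 ry.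
Qed.

End Perturbation.

(** * The exhaustion function *)

Section Exhaustion.
Context {R : realType} {n : nat}.
Implicit Types (z w : 'C[R]_n) (W : set 'C[R]_n) (u : 'C[R]_n -> R).

Lemma sqr_enorm_continuous : continuous (fun z : 'C[R]_n => dot z z).
Proof.
move=> z; apply: (@continuous_comp _ _ _ (fun z : 'C[R]_n => (z, z))
  (fun p => dot p.1 p.2)); last exact: dot_continuous.
exact: (cvg_pair cvg_id cvg_id).
Qed.

(** The cross term is a first harmonic and integrates to zero, so the mean is [|z|^2 + |w|^2]. *)
Lemma dot_submean z w : 2 * pi * dot z z <=
  cint (fun t : R => dot (z + cmul (cos t) (sin t) w) (z + cmul (cos t) (sin t) w)).
Proof.
pose c := 2 * dot z w; pose s := 2 * dot z (cmul 0 1 w).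
have -> : (fun t : R => dot (z + cmul (cos t) (sin t) w) (z + cmul (cos t) (sin t) w)) =
   (fun t => (dot z z + dot w w) + (c * cos t + s * sin t) +
      (0 * (cos t ^+ 2 - sin t ^+ 2) + 0 * (2 * cos t * sin t))).
  apply/funext => t.
  have -> : z + cmul (cos t) (sin t) w = z - cmul (cos t) (sin t) (- w) by vring.
  have Nw : cmul 0 1 (- w) = - cmul 0 1 w by vring.
  rewrite dot_sub_cmul Nw !dotNl !dotNr cos2Dsin2 /c /s; ring.
rewrite cint_trig2 ler_pM2l ?mulr_gt0 ?pi_gt0 // lerDl; exact: dot_ge0.
Qed.

Lemma max_submean W u1 u2 z w : {in W, continuous u1} -> {in W, continuous u2} ->
    (forall a b : R, a ^+ 2 + b ^+ 2 <= 1 -> W (z + cmul a b w)) ->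
    2 * pi * u1 z <= cint (fun t => u1 (z + cmul (cos t) (sin t) w)) ->
    2 * pi * u2 z <= cint (fun t => u2 (z + cmul (cos t) (sin t) w)) ->
  {in W, continuous (fun z => Num.max (u1 z) (u2 z))} ->
  2 * pi * Num.max (u1 z) (u2 z) <=
    cint (fun t => Num.max (u1 (z + cmul (cos t) (sin t) w))
                           (u2 (z + cmul (cos t) (sin t) w))).
Proof.
move=> c1 c2 hW h1 h2 cm.
have cc := circle_comp_continuous cm hW.
have m (u : 'C[R]_n -> R) : {in W, continuous u} ->
    (forall x, u x <= Num.max (u1 x) (u2 x)) ->
    2 * pi * u z <= cint (fun t => u (z + cmul (cos t) (sin t) w)) ->
    2 * pi * u z <= cint (fun t => Num.max (u1 (z + cmul (cos t) (sin t) w))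
                           (u2 (z + cmul (cos t) (sin t) w))).
  move=> cu hu h; apply: (le_trans h); apply: le_cint => //.
  exact: circle_comp_continuous cu hW.
case: (leP (u1 z) (u2 z)) => _.
  by apply: m => // x; rewrite le_max lexx orbT.
by apply: m => // x; rewrite le_max lexx.
Qed.

Lemma max_continuous_in W u1 u2 : {in W, continuous u1} -> {in W, continuous u2} ->
  {in W, continuous (fun z => Num.max (u1 z) (u2 z))}.
Proof.
move=> c1 c2 z Wz.
have E : (fun z => Num.max (u1 z) (u2 z)) =
    (fun z => (u1 z + u2 z + `|u1 z - u2 z|) / 2).
  by apply/funext => x; rewrite maxr_absE.
rewrite E; have k1 := c1 z Wz; have k2 := c2 z Wz.
exact: (cvgM (cvgD (cvgD k1 k2) (cvg_norm (cvgB k1 k2))) (cvg_cst _)).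
Qed.

Lemma compact_sqr_enorm_le (A : set 'C[R]_n) (c : R) : closed A ->
  compact (A `&` [set z | dot z z <= c]).
Proof.
move=> cA; apply: (@closed_enorm_bounded_compact _ _ _ (c + 1)).
  apply: closedI => //.
  apply: (@preimage_closed _ _ (fun z : 'C[R]_n => dot z z) [set t | t <= c]).
    by move=> z _; exact: sqr_enorm_continuous.
  exact: closed_le.
by move=> z [_ /=]; rewrite -sqr_enorm; have := enorm_ge0 z; nra.
Qed.

Lemma pseudoconvex_setT : pseudoconvex (setT : set 'C[R]_n).
Proof.
split; first exact: openT.
have cd : {in setT, continuous (fun z : 'C[R]_n => dot z z)}.
  by move=> z _; exact: sqr_enorm_continuous.
exists (fun z => dot z z); split => //.
  by apply/(psh_submean cd) => z w _; exact: dot_submean.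
by move=> c; apply: compact_sqr_enorm_le; exact: closedT.
Qed.

Lemma inv_sqr_dist_continuous W : open W -> W <> setT ->
  {in W, continuous (fun z => (dist W z) ^- 2)}.
Proof.
move=> oW WT z /set_mem Wz; have d0 := dist_gt0 oW WT Wz.
apply: cvgV; first by rewrite expf_eq0 /= gt_eqF.
by apply: cvg_sqr; exact: dist_continuous.
Qed.

Lemma inv_sqr_dist_submean W z w : open W -> W <> setT ->
    (forall zeta, boundary W zeta -> ~ W zeta -> pushed_disc W zeta ->
       ~ strict_disc W zeta) ->
    (forall a b : R, a ^+ 2 + b ^+ 2 <= 1 -> W (z + cmul a b w)) ->
  2 * pi * (dist W z) ^- 2 <=
    cint (fun t => (dist W (z + cmul (cos t) (sin t) w)) ^- 2).
Proof.
move=> oW WT hno hW; rewrite leNgt; apply/negP => hlt.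
pose G := fun p : R * R => (dist W (z + cmul p.1 p.2 w)) ^- 2.
have cG p : p.1 ^+ 2 + p.2 ^+ 2 <= 1 -> {for p, continuous G}.
  move=> hp; apply: (@continuous_comp _ _ _ (fun p : R * R => z + cmul p.1 p.2 w)
    (fun z => (dist W z) ^- 2)).
    by apply: cvgD; [exact: cvg_cst|exact: cmul_continuous].
  by apply: (inv_sqr_dist_continuous oW WT); rewrite inE; exact: hW.
have z0 : z + cmul 0 0 w = z by vring.
have [|x [y [b1 [b2 [c1 [c2 [e [r [xy e0 r0 hq]]]]]]]]] := disc_touching cG.
  by rewrite /G /= z0.
have add a b : z + cmul x y w + cmul a b w = z + cmul (x + a) (y + b) w by vring.
have [|zeta [bz Wz pz sz]] :=
    @touching_strict_disc _ _ W (z + cmul x y w) w b1 b2 c1 c2 e r oW WT (hW _ _ xy) e0 r0.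
  by move=> a b ab; have [h1 h2] := hq a b ab; rewrite add; split; [exact: hW|].
exact: (hno zeta).
Qed.

Lemma pseudoconvex_no_disc W : open W ->
    (forall zeta, boundary W zeta -> ~ W zeta -> pushed_disc W zeta ->
       ~ strict_disc W zeta) ->
  pseudoconvex W.
Proof.
move=> oW hno; have [->|WT] := pselect (W = setT); first exact: pseudoconvex_setT.
have c1 := inv_sqr_dist_continuous oW WT.
have c2 : {in W, continuous (fun z : 'C[R]_n => dot z z)}.
  by move=> z _; exact: sqr_enorm_continuous.
have cm := max_continuous_in c1 c2.
split => //; exists (fun z => Num.max ((dist W z) ^- 2) (dot z z)); split => //.
  apply/(psh_submean cm) => z w hW.
  apply: (max_submean c1 c2 hW) => //; last exact: dot_submean.
  exact: inv_sqr_dist_submean.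
move=> c.
(* Since [dist W] vanishes off [W], the inequality [1 <= c * dist^2] forces membership in [W], and
   it defines a closed subset of the whole space. *)
have -> : W `&` [set z | Num.max ((dist W z) ^- 2) (dot z z) <= c] =
    [set z | 1 <= c * dist W z ^+ 2] `&` [set z | dot z z <= c].
  apply/seteqP; split=> z /=; rewrite ge_max.
    move=> [Wz /andP[h1 h2]]; split => //.
    have d0 := dist_gt0 oW WT Wz.
    by rewrite -ler_pdivrMr ?exprn_gt0 // mul1r.
  move=> [h1 h2].
  have Wz : W z.
    apply: contrapT => /(dist_le z); rewrite subrr enorm0 => h3.
    have [v _ dv] := dist_nearest z oW WT.
    have d0 : dist W z = 0.
      by apply: le_anti; rewrite h3 dv enorm_ge0.
    by move: h1; rewrite d0 expr0n mulr0 ler10.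
  split => //; rewrite h2 andbT.
  have d0 := dist_gt0 oW WT Wz.
  by move: h1; rewrite -ler_pdivrMr ?exprn_gt0 // mul1r.
apply: compact_sqr_enorm_le.
apply: (@preimage_closed _ _ (fun z : 'C[R]_n => c * dist W z ^+ 2) [set t | 1 <= t]).
  move=> z _; apply: cvgM; first exact: cvg_cst.
  by apply: cvg_sqr; exact: dist_continuous.
exact: closed_ge.
Qed.

End Exhaustion.

(** * Discs at boundary points on and off the exceptional set *)

Theorem proposition2p1 (R : realType) (n : nat) (Omega F : set 'C[R]_n)
  (hOmega : domain Omega)
  (F_closed : closed F) (F_sub : F `<=` boundary Omega)
  (hsmooth : C2_boundary_near Omega F)
  (hloc : forall zeta, (boundary Omega `\` F) zeta ->
     locally_pseudoconvex_at Omega zeta)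
  (F_int : interior (F : set (subspace (boundary Omega))) = set0) :
  pseudoconvex Omega.
Proof.
have [oO _ _] := hOmega.
have bdry_out z : boundary Omega z -> ~ Omega z.
  by move=> [_ +] Oz; apply; apply: open_nbhs_nbhs.
have no_pushed z : boundary Omega z -> ~ F z -> ~ pushed_disc Omega z.
  move=> bz Fz; apply: locally_pseudoconvex_no_pushed_disc; first exact: bdry_out.
  exact: hloc.
apply: pseudoconvex_no_disc => // zeta bz _ pz sz.
have [Fz|Fz] := pselect (F zeta); last exact: (no_pushed zeta).
have [U [_ FU hU]] := hsmooth.
have [V [rho [oV Vz hrho]]] := hU zeta (conj bz (FU _ Fz)).
have [d d0 hd] := strict_disc_perturb oV Vz hrho bz sz.
(* Every boundary point near [zeta] carries a pushed disc and therefore belongs to [F], which makes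
   [F] a relative neighbourhood of [zeta]. *)
suff : interior (F : set (subspace (boundary Omega))) zeta by rewrite F_int.
suff : within (boundary Omega) (nbhs zeta) F by rewrite (nbhs_subspace_in bz).
apply/nbhs_eballP; exists d => // z zd bz'.
by apply: contrapT => Fz'; exact: (no_pushed z bz' Fz' (hd z zd bz')).
Qed.
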